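(* Let $n\ge 3$ and let $(M^n,g,f)$ be a compact gradient Yamabe soliton, not necessarily locally conformally flat. Then $g$ is a metric of constant scalar curvature.
   Context: $(M,g,f)$ is a gradient Yamabe soliton if $g$ is a Riemannian metric on the smooth $n$-manifold $M$ with scalar curvature $R$, $f:M\to\mathbb{R}$ is a smooth function, and there is a constant $\rho\in\mathbb{R}$ with $(R-\rho)\,g_{ij}=\nabla_i\nabla_j f$. Compact means compact without boundary. No assumption on the sign of the curvature is made. *)

(* Defs.v *)
From HB Require Import structures.
From mathcomp Require Import all_boot all_order all_algebra.
From mathcomp Require Import all_classical all_reals all_analysis.

Set Implicit Arguments.
Unset Strict Implicit.
Unset Printing Implicit Defensive.

Import Order.TTheory GRing.Theory Num.Theory.
Import numFieldNormedType.Exports.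

Local Open Scope classical_set_scope.
Local Open Scope ring_scope.

Definition pderiv (R : realType) (n : nat) (i : 'I_n) (F : 'rV[R]_n -> R) :
    'rV[R]_n -> R :=
  fun x => 'D_(delta_mx 0 i) F x.

(* C^oo on U, meant for U open: [foldr pderiv F s] is the iterated partial
   derivative of F along the list s (F itself for s = [::]). Asking that all
   of them be differentiable on U is the same as asking that all of them exist
   and be continuous on U. *)
Definition smooth_on (R : realType) (n : nat) (U : set 'rV[R]_n)
    (F : 'rV[R]_n -> R) : Prop :=
  forall (s : seq 'I_n) (x : 'rV[R]_n),
    U x -> differentiable (foldr (@pderiv R n) F s) x.

(* Manifolds without boundary: the charts have open image in R^n. The atlas is
   any smooth atlas, not necessarily a maximal one. [chart_inv i] is the inverse
   of the chart [chart_map i]; its values outside [chart_map i @` chart_dom i]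
   are irrelevant. *)
Record smoothManifold (R : realType) (n : nat) := SmoothManifold {
  point_of :> topologicalType;
  chart : Type;
  chart_dom : chart -> set point_of;
  chart_map : chart -> point_of -> 'rV[R]_n;
  chart_inv : chart -> 'rV[R]_n -> point_of;
  manifold_hausdorff : hausdorff_space point_of;
  manifold_second_countable : @second_countable point_of;
  chart_dom_cover : forall p, exists i, chart_dom i p;
  chart_dom_open : forall i, open (chart_dom i);
  chart_image_open : forall i, open (chart_map i @` chart_dom i);
  chart_mapK : forall i p, chart_dom i p -> chart_inv i (chart_map i p) = p;
  chart_map_continuous :
    forall i, {within chart_dom i, continuous (chart_map i)};
  chart_inv_continuous :
    forall i, {within chart_map i @` chart_dom i, continuous (chart_inv i)};
  transition_smooth : forall (i j : chart) (a : 'I_n),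
    smooth_on (chart_map i @` (chart_dom i `&` chart_dom j))
      (fun x => chart_map j (chart_inv i x) 0 a) }.

Definition smooth_function (R : realType) (n : nat) (M : smoothManifold R n)
    (f : M -> R) : Prop :=
  forall i : chart M, smooth_on (chart_map i @` chart_dom i) (f \o chart_inv i).

(* A Riemannian metric given by its components: [gram i x a b] is g_ab at the
   point of coordinates x in the chart i, and [gram_transition] is the
   transformation law of a covariant 2-tensor. Components at coordinates
   outside [chart_map i @` chart_dom i] are irrelevant. *)
Record riemannianMetric (R : realType) (n : nat) (M : smoothManifold R n) :=
  RiemannianMetric {
  gram :> chart M -> 'rV[R]_n -> 'M[R]_n;
  gram_smooth : forall (i : chart M) (a b : 'I_n),
    smooth_on (chart_map i @` chart_dom i) (fun x => gram i x a b);
  gram_sym : forall i x, (chart_map i @` chart_dom i) x ->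
    (gram i x)^T = gram i x;
  gram_posdef : forall i x, (chart_map i @` chart_dom i) x ->
    forall v : 'rV[R]_n, v != 0 -> 0 < (v *m gram i x *m v^T) 0 0;
  gram_transition : forall (i j : chart M) x,
    (chart_map i @` (chart_dom i `&` chart_dom j)) x ->
    forall a b : 'I_n,
      let tau := fun y => chart_map j (chart_inv i y) in
      gram i x a b = \sum_(c < n) \sum_(d < n)
        pderiv a (fun y => tau y 0 c) x * pderiv b (fun y => tau y 0 d) x *
        gram j (tau x) c d }.

(* [christoffel G k i j] is Gamma^k_ij for the metric components G. *)
Definition christoffel (R : realType) (n : nat) (G : 'rV[R]_n -> 'M[R]_n)
    (k i j : 'I_n) (x : 'rV[R]_n) : R :=
  2^-1 * \sum_(l < n) invmx (G x) k l *
    (pderiv i (fun y => G y j l) x + pderiv j (fun y => G y i l) x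
     - pderiv l (fun y => G y i j) x).

(* [riemann_coord G l k i j] is the component along e_l of
   Rm(e_i, e_j) e_k = nabla_i nabla_j e_k - nabla_j nabla_i e_k. *)
Definition riemann_coord (R : realType) (n : nat) (G : 'rV[R]_n -> 'M[R]_n)
    (l k i j : 'I_n) (x : 'rV[R]_n) : R :=
  pderiv i (christoffel G l j k) x - pderiv j (christoffel G l i k) x
  + \sum_(m < n) (christoffel G l i m x * christoffel G m j k x
                  - christoffel G l j m x * christoffel G m i k x).

Definition ricci_coord (R : realType) (n : nat) (G : 'rV[R]_n -> 'M[R]_n)
    (j k : 'I_n) (x : 'rV[R]_n) : R :=
  \sum_(i < n) riemann_coord G i k i j x.

Definition scalar_coord (R : realType) (n : nat) (G : 'rV[R]_n -> 'M[R]_n)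
    (x : 'rV[R]_n) : R :=
  \sum_(j < n) \sum_(k < n) invmx (G x) j k * ricci_coord G j k x.

Definition hessian_coord (R : realType) (n : nat) (G : 'rV[R]_n -> 'M[R]_n)
    (F : 'rV[R]_n -> R) (i j : 'I_n) (x : 'rV[R]_n) : R :=
  pderiv i (pderiv j F) x - \sum_(k < n) christoffel G k i j x * pderiv k F x.

(* The scalar curvature at p, computed in the chart i, and the components at p
   of the metric and of the Hessian in the chart i; meant for p in
   [chart_dom i]. As the scalar curvature is a function on M, the value of
   [scalar_curvature g i p] does not depend on such an i; statements about it
   are made in every chart around p. *)
Definition scalar_curvature (R : realType) (n : nat) (M : smoothManifold R n)
    (g : riemannianMetric M) (i : chart M) (p : M) : R :=
  scalar_coord (g i) (chart_map i p).

Definition metric_at (R : realType) (n : nat) (M : smoothManifold R n)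
    (g : riemannianMetric M) (i : chart M) (p : M) (a b : 'I_n) : R :=
  g i (chart_map i p) a b.

Definition hessian_at (R : realType) (n : nat) (M : smoothManifold R n)
    (g : riemannianMetric M) (f : M -> R) (i : chart M) (p : M)
    (a b : 'I_n) : R :=
  hessian_coord (g i) (f \o chart_inv i) a b (chart_map i p).

Definition gradient_yamabe_soliton (R : realType) (n : nat)
    (M : smoothManifold R n) (g : riemannianMetric M) (f : M -> R) : Prop :=
  smooth_function f /\
  exists rho : R, forall (i : chart M) (p : M), chart_dom i p ->
    forall a b : 'I_n,
      (scalar_curvature g i p - rho) * metric_at g i p a b
      = hessian_at g f i p a b.

Definition constant_scalar_curvature (R : realType) (n : nat)
    (M : smoothManifold R n) (g : riemannianMetric M) : Prop :=
  exists c : R, forall (i : chart M) (p : M), chart_dom i p ->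
    scalar_curvature g i p = c.

(* Main.v *)
From HB Require Import structures.
Require Import Defs.
From mathcomp Require Import all_boot all_order all_algebra.
From mathcomp Require Import all_classical all_reals all_analysis.
From mathcomp Require Import ring lra.

Set Implicit Arguments.
Unset Strict Implicit.
Unset Printing Implicit Defensive.

Import Order.TTheory GRing.Theory Num.Theory.
Import numFieldNormedType.Exports.

Local Open Scope classical_set_scope.
Local Open Scope ring_scope.

(** The classical proof integrates [(R - rho)^2] over [M]. Below, a function
that is monotone along the gradient of [f] and the extreme value theorem take
the place of the integral.

Write [phi = R - rho], [V = grad f], [u = |V|^2]. The soliton equation says
that [nabla V = phi id]. Hence [du = 2 phi df], and commuting derivatives gives
[Rm(X, Y) V = X(phi) Y - Y(phi) X] ([curv_grad]), so that
[Ric(V) = (1 - n) grad phi] ([ricci_grad]) and, by the symmetries of the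
curvature, [dphi] is parallel to [df] ([dphi_parallel_df]). Taking the
divergence of [Ric(V)], the contracted second Bianchi identity
([contracted_bianchi]) yields [V(R) = - 2 (n - 1) Lap(phi) - 2 phi R]. As
[dphi] is parallel to [df], the Laplacian can be expressed by iterated
derivatives along [V] ([Dgrad_Dgrad]), and there remains an ordinary
differential equation along [V] ([radial_identity]):
[2 (n - 1) (V(V(phi)) + (n - 2) phi V(phi)) + u V(phi) + 2 u phi R = 0].

Let [Q = u^((n-2)/2) ((n - 1) V(phi) + phi u / 2 + rho u / n)] ([flux]). The
differential equation turns into [V(Q) = (n - 2)/2 u^(n/2) phi^2 >= 0]
([is_derive_flux]), and, because [n >= 3], [Q] vanishes where [V] does. For
[eps > 0] the function [Q + eps f] strictly increases along [V] wherever
[V <> 0], so its extrema on the compact [M] are critical points of [f], where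
[Q = 0]. Therefore [eps (min f - f) <= Q <= eps (max f - f)], and [Q = 0] when
[eps] tends to 0 ([flux_eq0]). Then [u^(n/2) phi^2 = 0]: near a point where
[phi <> 0] the gradient of [f] would vanish identically, hence so would its
Hessian [phi g], which is absurd. So [R = rho] everywhere, with the same
constant on all components of [M].

The curvature identities are proved in a commutative ring with commuting
derivations, and then applied to the ring [smooth_fun] of smooth functions on
the image of a chart; there, the Leibniz rule and the commutation of
derivatives hold without side conditions. To glue the local functions [Q]
together, only the invariance of the inner product of two gradients
([grad_dot_chart]) is established: off the critical points, [phi] and [V(phi)]
are rational functions of [u], [V(u)] and [V(V(u))]. *)

(** * Curvature identities over a ring with commuting derivations *)

(** Turns an identity between sums of matrix products into an identity between
entries in which the products are atoms: the tactic [ring], which is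
commutative, then proves it. *)
Ltac mx_expand :=
  rewrite ?(mulmxDl, mulmxDr, mulNmx, mulmxN, opprD, opprK, mulmxA);
  repeat first [rewrite [fun_of_matrix (_ + _) _ _]mxE |
                rewrite [fun_of_matrix (- _) _ _]mxE |
                rewrite [fun_of_matrix 0 _ _]mxE].

(** [K] stands for the functions on the image of a chart, [d i] for the partial
derivatives, [g] and [h] for the metric and its inverse. *)
Section FormalGeometry.
Context {n : nat} {K : comPzRingType} (d : 'I_n -> K -> K).
Hypothesis dD : forall i, {morph d i : x y / x + y}.
Hypothesis dM : forall i x y, d i (x * y) = d i x * y + x * d i y.
Hypothesis dC : forall i j x, d i (d j x) = d j (d i x).

Lemma d_0 i : d i 0 = 0.
Proof. by apply: (@addrI _ (d i 0)); rewrite -dD !addr0. Qed.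
Lemma d_N i x : d i (- x) = - d i x.
Proof. by apply: (@addrI _ (d i x)); rewrite -dD !subrr d_0. Qed.
Lemma d_1 i : d i 1 = 0.
Proof.
by apply: (@addrI _ (d i 1)); rewrite addr0 -{3}[1]mulr1 dM mulr1 mul1r.
Qed.
Lemma d_sum i (I : Type) (r : seq I) P (F : I -> K) :
  d i (\sum_(k <- r | P k) F k) = \sum_(k <- r | P k) d i (F k).
Proof. exact: (big_morph _ (dD i) (d_0 i)). Qed.

Definition dmx i p q (A : 'M[K]_(p, q)) : 'M[K]_(p, q) := map_mx (d i) A.

Lemma dmxD i p q (A B : 'M[K]_(p, q)) : dmx i (A + B) = dmx i A + dmx i B.
Proof. by apply/matrixP=> a b; rewrite !mxE dD. Qed.
Lemma dmxN i p q (A : 'M[K]_(p, q)) : dmx i (- A) = - dmx i A.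
Proof. by apply/matrixP=> a b; rewrite !mxE d_N. Qed.
Lemma dmxB i p q (A B : 'M[K]_(p, q)) : dmx i (A - B) = dmx i A - dmx i B.
Proof. by rewrite dmxD dmxN. Qed.
Lemma dmxM i p q r (A : 'M[K]_(p, q)) (B : 'M[K]_(q, r)) :
  dmx i (A *m B) = dmx i A *m B + A *m dmx i B.
Proof.
apply/matrixP=> a b; rewrite !mxE d_sum -big_split /=.
by apply: eq_bigr => k _; rewrite !mxE dM.
Qed.
Lemma dmxZ i p q x (A : 'M[K]_(p, q)) :
  dmx i (x *: A) = d i x *: A + x *: dmx i A.
Proof. by apply/matrixP=> a b; rewrite !mxE dM. Qed.
Lemma dmx_tr i p q (A : 'M[K]_(p, q)) : dmx i A^T = (dmx i A)^T.
Proof. by rewrite /dmx map_trmx. Qed.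
Lemma dmx1 i p : dmx i (1%:M : 'M[K]_p) = 0.
Proof.
by apply/matrixP=> a b; rewrite !mxE; case: (a == b); rewrite ?d_1 ?d_0.
Qed.
Lemma dmx_delta i p q a b : dmx i (delta_mx a b : 'M[K]_(p, q)) = 0.
Proof.
by apply/matrixP=> k l; rewrite !mxE; case: (_ && _); rewrite ?d_1 ?d_0.
Qed.
Lemma dmxC i j p q (A : 'M[K]_(p, q)) : dmx i (dmx j A) = dmx j (dmx i A).
Proof. by apply/matrixP=> a b; rewrite !mxE dC. Qed.

Variables (half : K) (g h : 'M[K]_n).
Hypothesis half2 : half + half = 1.
Hypothesis gh : g *m h = 1%:M.
Hypothesis hg : h *m g = 1%:M.
Hypothesis gT : g^T = g.

Definition chris (k i j : 'I_n) : K :=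
  half * \sum_l h k l * (d i (g j l) + d j (g i l) - d l (g i j)).

(** The connection matrices: [nabla_i X = d_i X + conn i X] on column vectors.
*)
Definition conn (i : 'I_n) : 'M[K]_n := \matrix_(l, k) chris l i k.

Lemma metricC a b : g a b = g b a.
Proof. by rewrite -{1}gT mxE. Qed.

Lemma cometric_sym : h^T = h.
Proof.
have: h^T *m g = 1%:M by rewrite -{1}gT -trmx_mul gh trmx1.
by move=> /(congr1 (fun A => A *m h)); rewrite -mulmxA gh mulmx1 mul1mx.
Qed.

Lemma cometricC a b : h a b = h b a.
Proof. by rewrite -{1}cometric_sym mxE. Qed.

Lemma chrisC k i j : chris k i j = chris k j i.
Proof.
rewrite /chris; congr (_ * _); apply: eq_bigr => l _.
by rewrite (metricC j i) (addrC (d i _)).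
Qed.

Lemma metric_connE i j k :
  (g *m conn i) j k = half * (d i (g k j) + d k (g i j) - d j (g i k)).
Proof.
rewrite !mxE; under eq_bigr => m _ do rewrite !mxE /chris mulrCA mulr_sumr.
rewrite -mulr_sumr; congr (_ * _); rewrite exchange_big /=.
transitivity (\sum_l (g *m h) j l * (d i (g k l) + d k (g i l) - d l (g i k))).
  apply: eq_bigr => l _; rewrite mxE mulr_suml.
  by apply: eq_bigr => m _; rewrite mulrA.
rewrite gh (bigD1 j)//= mxE eqxx mul1r big1 ?addr0// => l nl.
by rewrite mxE eq_sym (negPf nl) mul0r.
Qed.

(** [nabla g = 0]: with the index lowered, the Christoffel symbols are half
sums of derivatives of [g], of which all but one cancel in pairs. *)
Lemma d_metric i : dmx i g = (conn i)^T *m g + g *m conn i.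
Proof.
apply/matrixP=> j k; rewrite -{2}gT -trmx_mul.
rewrite [RHS]mxE [X in _ = X + _]mxE !metric_connE !mxE (metricC k j).
rewrite -[LHS]mul1r -half2; ring.
Qed.

(** [nabla h = 0], by differentiating [g h = 1]. *)
Lemma d_cometric i : dmx i h = - (conn i *m h + h *m (conn i)^T).
Proof.
have: dmx i (g *m h) = 0 by rewrite gh dmx1.
rewrite dmxM d_metric => /(congr1 (fun A => h *m A)).
rewrite mulmx0 mulmxDr [h *m (g *m _)]mulmxA hg mul1mx => /eqP.
rewrite addrC addr_eq0 => /eqP ->.
by rewrite mulmxDl mulmxDr -(mulmxA _ g h) gh mulmx1 !mulmxA hg mul1mx addrC.
Qed.

(** The commutator of [nabla_i] and [nabla_j]. *)
Definition curv i j : 'M[K]_n :=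
  dmx i (conn j) - dmx j (conn i) + (conn i *m conn j - conn j *m conn i).

Lemma curvN i j : curv i j = - curv j i.
Proof.
rewrite /curv !opprD !opprK (addrC (- _) (dmx i _)).
by rewrite (addrC (- _) (_ *m _)).
Qed.

(** The curvature with its second matrix index raised. *)
Definition curv2 i j := curv i j *m h.

(** Since [h] is parallel, the commutation of [d i] and [d j] on [h] says that
the curvature acts trivially on it. *)
Lemma curv2_tr i j : (curv2 i j)^T = - curv2 i j.
Proof.
have /matrixP E := dmxC i j h.
move: E; rewrite !d_cometric !dmxN !dmxD !dmxM !d_cometric !dmx_tr => E.
rewrite /curv2 /curv trmx_mul cometric_sym linearD linearB linearB /= !trmx_mul.
apply/matrixP => a b; move: {E} (E a b).
mx_expand => /eqP; rewrite -subr_eq0 => /eqP E.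
apply/eqP; rewrite -subr_eq0; apply/eqP; rewrite -[RHS]oppr0 -E; ring.
Qed.

(** Each pair of terms of the cyclic sum cancels by the symmetry [conn i e_j =
conn j e_i] of the connection. *)
Lemma bianchi1 i j k : curv i j *m delta_mx k (0 : 'I_1) +
  curv j k *m delta_mx i 0 + curv k i *m delta_mx j 0 = 0.
Proof.
have T a b : conn a *m delta_mx b (0 : 'I_1) = conn b *m delta_mx a 0.
  by rewrite -!colE; apply/matrixP => x y; rewrite !mxE chrisC.
have T' c a b : dmx c (conn a) *m delta_mx b (0 : 'I_1) =
    dmx c (conn b) *m delta_mx a 0.
  have := congr1 (@dmx c _ _) (T a b).
  by rewrite !dmxM !dmx_delta !mulmx0 !addr0.
rewrite /curv; apply/matrixP => a b; mx_expand.
rewrite -!mulmxA (T i j) (T j k) (T k i) (T' i j) (T' j k) (T' k i); ring.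
Qed.

(** The Jacobi identity for the operators [d i + conn i]. *)
Lemma bianchi2 m i j :
  (dmx m (curv i j) + (conn m *m curv i j - curv i j *m conn m)) +
  (dmx i (curv j m) + (conn i *m curv j m - curv j m *m conn i)) +
  (dmx j (curv m i) + (conn j *m curv m i - curv m i *m conn j)) = 0.
Proof.
rewrite /curv !(dmxD, dmxN, dmxM).
rewrite (dmxC m i) (dmxC i j) (dmxC m j).
apply/matrixP => a b; mx_expand; ring.
Qed.

(** Raising an index commutes with [nabla], because [h] is parallel. *)
Lemma cov_curv2 m i j :
  dmx m (curv2 i j) + conn m *m curv2 i j + curv2 i j *m (conn m)^T =
  (dmx m (curv i j) + (conn m *m curv i j - curv i j *m conn m)) *m h.
Proof.
by rewrite /curv2 dmxM d_cometric; apply/matrixP => a b; mx_expand; ring.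
Qed.

Lemma bianchi2_curv2 m i j :
  (dmx m (curv2 i j) + conn m *m curv2 i j + curv2 i j *m (conn m)^T) +
  (dmx i (curv2 j m) + conn i *m curv2 j m + curv2 j m *m (conn i)^T) +
  (dmx j (curv2 m i) + conn j *m curv2 m i + curv2 m i *m (conn j)^T) = 0.
Proof. by rewrite !cov_curv2 -!mulmxDl bianchi2 mul0mx. Qed.

Lemma curv2N i j a b : curv2 i j a b = - curv2 i j b a.
Proof. by have /matrixP/(_ b a) := curv2_tr i j; rewrite !mxE. Qed.
Lemma curv2Nl i j a b : curv2 i j a b = - curv2 j i a b.
Proof. by rewrite /curv2 curvN mulNmx mxE. Qed.

Lemma double0 (x : K) : x = - x -> x = 0.
Proof. by move=> E; rewrite -[x]mul1r -half2 mulrDl {2}E mulrN subrr. Qed.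

Lemma antisym_sum0 (A B : 'I_n -> 'I_n -> K) :
  (forall i j, A i j = - A j i) -> (forall i j, B i j = B j i) ->
  \sum_i \sum_j A i j * B i j = 0.
Proof.
move=> hA hB; apply: double0; rewrite [LHS]exchange_big -sumrN /=.
apply: eq_bigr => i _; rewrite -sumrN; apply: eq_bigr => j _.
by rewrite hA hB mulNr.
Qed.

(** The Ricci tensor with its second index raised. *)
Definition ricci_up (i m : 'I_n) : K := \sum_j curv2 j m j i.
Definition scalar_curv : K := \sum_i \sum_j curv2 i j i j.
(** The logarithmic derivative of the volume density, through which the
connection enters the divergence of a vector field. *)
Definition conn_trace (l : 'I_n) : K := \sum_i chris i i l.

(** The double trace of the second Bianchi identity, that is [nabla_m R = 2
nabla_i Ric^i_m]. *)
Lemma contracted_bianchi m :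
  d m scalar_curv =
    (\sum_i d i (ricci_up i m) + \sum_l conn_trace l * ricci_up l m
     - \sum_i \sum_l chris i m l * ricci_up l i) *+ 2.
Proof.
have B : \sum_i \sum_j
  ((dmx m (curv2 i j) + conn m *m curv2 i j + curv2 i j *m (conn m)^T) i j +
  (dmx i (curv2 j m) + conn i *m curv2 j m + curv2 j m *m (conn i)^T) i j +
  (dmx j (curv2 m i) + conn j *m curv2 m i + curv2 m i *m (conn j)^T) i j) = 0.
  apply: big1 => i _; apply: big1 => j _.
  have /matrixP/(_ i j) := bianchi2_curv2 m i j.
  by rewrite [X in X = _]mxE [X in X + _ = _]mxE [X in _ = X]mxE.
have T1 : \sum_i \sum_j
    (dmx m (curv2 i j) + conn m *m curv2 i j + curv2 i j *m (conn m)^T) i j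
  = d m scalar_curv + (\sum_i \sum_l chris i m l * ricci_up l i) *+ 2.
  rewrite mulr2n addrA.
  under eq_bigr => i _ do under eq_bigr => j _ do rewrite 2!mxE.
  under eq_bigr => i _ do rewrite 2!big_split /=.
  rewrite 2!big_split /=; congr (_ + _ + _).
  - rewrite /scalar_curv d_sum; apply: eq_bigr => i _; rewrite d_sum.
    by apply: eq_bigr => j _; rewrite mxE.
  - apply: eq_bigr => i _; under eq_bigr => j _ do rewrite mxE.
    rewrite exchange_big; apply: eq_bigr => l _ /=.
    rewrite /ricci_up mulr_sumr; apply: eq_bigr => j _.
    by rewrite [conn _ _ _]mxE curv2N curv2Nl opprK.
  - rewrite exchange_big; apply: eq_bigr => j _.
    under eq_bigr => i _ do rewrite mxE.
    rewrite exchange_big; apply: eq_bigr => l _ /=.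
    rewrite /ricci_up mulr_sumr; apply: eq_bigr => i _.
    by rewrite [(conn m)^T _ _]mxE [conn _ _ _]mxE mulrC.
(* The last product pairs an antisymmetric with a symmetric array. *)
have T2 : \sum_i \sum_j
    (dmx i (curv2 j m) + conn i *m curv2 j m + curv2 j m *m (conn i)^T) i j
  = - (\sum_i d i (ricci_up i m) + \sum_l conn_trace l * ricci_up l m).
  under eq_bigr => i _ do under eq_bigr => j _ do rewrite 2!mxE.
  under eq_bigr => i _ do rewrite 2!big_split /=.
  rewrite 2!big_split /= [X in _ + X](_ : _ = 0) ?addr0; last first.
    rewrite exchange_big; apply: big1 => j _ /=.
    under eq_bigr => i _ do rewrite mxE.
    under eq_bigr => i _ do under eq_bigr => l _ do
      rewrite [(conn _)^T _ _]mxE [conn _ _ _]mxE.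
    apply: (@antisym_sum0 (fun a b => curv2 j m a b) (fun a b => chris j a b)).
      by move=> a b; exact: curv2N.
    by move=> a b; exact: chrisC.
  rewrite opprD; congr (_ + _); rewrite -sumrN.
    apply: eq_bigr => i _; rewrite /ricci_up -d_N -sumrN d_sum.
    by apply: eq_bigr => j _; rewrite [dmx _ _ _ _]mxE curv2N opprK.
  under eq_bigr => i _ do under eq_bigr => j _ do rewrite mxE.
  under eq_bigr => i _ do rewrite exchange_big /=.
  rewrite exchange_big; apply: eq_bigr => l _ /=.
  rewrite /conn_trace -mulNr -sumrN mulr_suml; apply: eq_bigr => i _.
  rewrite /ricci_up mulr_sumr; apply: eq_bigr => j _.
  by rewrite [conn _ _ _]mxE [curv2 j m l j]curv2N mulrN mulNr.
(* Exchanging i and j turns this sum into the previous one. *)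
have T3 : \sum_i \sum_j
    (dmx j (curv2 m i) + conn j *m curv2 m i + curv2 m i *m (conn j)^T) i j
  = - (\sum_i d i (ricci_up i m) + \sum_l conn_trace l * ricci_up l m).
  rewrite exchange_big -T2; apply: eq_bigr => i _; apply: eq_bigr => j _ /=.
  have -> : curv2 m j = (curv2 j m)^T by rewrite curv2_tr /curv2 curvN mulNmx.
  rewrite dmx_tr.
  have -> : conn i *m (curv2 j m)^T = (curv2 j m *m (conn i)^T)^T.
    by rewrite [RHS]trmx_mul trmxK.
  have -> : (curv2 j m)^T *m (conn i)^T = (conn i *m curv2 j m)^T.
    by rewrite [RHS]trmx_mul.
  by rewrite -!linearD mxE -addrA (addrC (_ *m (conn i)^T)) addrA.
move: B; under eq_bigr => i _ do rewrite 2!big_split /=.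
rewrite 2!big_split /= T1 T2 T3 => /eqP.
rewrite -addrA addr_eq0 -addr_eq0 -addrA addr_eq0 => /eqP ->.
ring.
Qed.

Variables f phi : K.
Hypothesis hess : forall i j,
  d i (d j f) - \sum_k chris k i j * d k f = phi * g i j.

Definition covec (a : K) : 'cV[K]_n := \col_k d k a.
Definition gradient (a : K) : 'cV[K]_n := h *m covec a.
Local Notation df := (covec f).
Local Notation grad := (gradient f).
Local Notation gphi := (gradient phi).
Definition Dgrad (a : K) : K := \sum_k grad k 0 * d k a.
Definition e_ (i : 'I_n) : 'cV[K]_n := delta_mx i 0.

Lemma d_df i : dmx i df = (conn i)^T *m df + phi *: (g *m e_ i).
Proof.
apply/matrixP => j z; rewrite -colE !mxE [g j i]metricC -hess.
under [X in X + _]eq_bigr => k _ do rewrite !mxE.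
by rewrite addrC subrK.
Qed.

(** The soliton equation with an index raised. *)
Lemma d_grad i : dmx i grad = phi *: e_ i - conn i *m grad.
Proof.
rewrite /gradient dmxM d_cometric d_df mulNmx mulmxDl mulmxDr -scalemxAr.
rewrite (mulmxA h g) hg mul1mx.
by apply/matrixP => a b; mx_expand; ring.
Qed.

Lemma conn_e i j : conn i *m e_ j = conn j *m e_ i.
Proof. by rewrite /e_ -!colE; apply/matrixP => x y; rewrite !mxE chrisC. Qed.

(** As [nabla grad f = phi id], the commutator of two covariant derivatives of
[grad f] only involves the derivatives of [phi]. *)
Lemma curv_grad i j : curv i j *m grad = d i phi *: e_ j - d j phi *: e_ i.
Proof.
have E a b : dmx a (dmx b grad) = d a phi *: e_ b - dmx a (conn b) *m grad
     - phi *: (conn b *m e_ a) + conn b *m conn a *m grad.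
  rewrite d_grad dmxB dmxZ dmx_delta scaler0 addr0 dmxM d_grad.
  by apply/matrixP => x y; mx_expand; rewrite -scalemxAr; ring.
have /matrixP E' := dmxC i j grad; apply/matrixP => a b; move: (E' a b).
rewrite !E /curv (conn_e i j); mx_expand => /eqP; rewrite -subr_eq0 => /eqP {}E.
by apply/eqP; rewrite -subr_eq0; apply/eqP; rewrite -[RHS]oppr0 -E; ring.
Qed.

Definition ricci (j k : 'I_n) : K := \sum_i curv i j i k.

Lemma curv_tr0 i j : \sum_k curv i j k k = 0.
Proof.
have -> : curv i j = curv2 i j *m g by rewrite /curv2 -mulmxA hg mulmx1.
transitivity (\sum_k \sum_l curv2 i j k l * g l k).
  by apply: eq_bigr => k _; rewrite mxE.
apply: (@antisym_sum0 (fun k l => curv2 i j k l) (fun k l => g l k)).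
  by move=> a b; exact: curv2N.
by move=> a b; rewrite metricC.
Qed.

(** The trace of the first Bianchi identity, one term of which vanishes by
[curv_tr0]. *)
Lemma ricciC j k : ricci j k = ricci k j.
Proof.
have B i : curv i j i k + curv j k i i + curv k i i j = 0.
  have /matrixP/(_ i 0) := bianchi1 i j k.
  rewrite -!colE [RHS]mxE => <-.
  by rewrite 2![fun_of_matrix (_ + _) i 0]mxE ![col _ _ _ _]mxE.
have : \sum_i (curv i j i k + curv j k i i + curv k i i j) = 0 by apply: big1.
rewrite 2!big_split /= curv_tr0 addr0 => /eqP; rewrite addr_eq0 => /eqP.
rewrite -/(ricci j k) => ->; rewrite -sumrN; apply: eq_bigr => i _.
by rewrite curvN mxE opprK.
Qed.

Lemma ricci_upE i m : ricci_up i m = \sum_k ricci m k * h k i.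
Proof.
rewrite /ricci_up /ricci; under [RHS]eq_bigr => k _ do rewrite mulr_suml.
by rewrite exchange_big; apply: eq_bigr => j _; rewrite mxE.
Qed.

(** The trace of [curv_grad]. *)
Lemma ricci_grad j : \sum_k ricci j k * grad k 0 = (1 - n%:R) * d j phi.
Proof.
under eq_bigr => k _ do rewrite mulr_suml.
rewrite exchange_big /=.
under eq_bigr => i _.
  have -> : \sum_k curv i j i k * grad k 0 = d i phi * (i == j)%:R - d j phi.
    have /matrixP/(_ i 0) := curv_grad i j.
    by rewrite [X in X = _]mxE => ->; rewrite !mxE !eqxx !andbT mulr1.
  over.
rewrite big_split /= (bigD1 j)//= eqxx mulr1 big1 ?addr0; last first.
  by move=> i /negPf ->; rewrite mulr0.
by rewrite sumr_const card_ord mulNrn -mulr_natl; ring.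
Qed.

Definition divergence (X : 'cV[K]_n) : K :=
  \sum_i d i (X i 0) + \sum_l conn_trace l * X l 0.

Lemma ricci_up_grad i : \sum_m ricci_up i m * grad m 0 = (1 - n%:R) * gphi i 0.
Proof.
under eq_bigr => m _ do rewrite ricci_upE mulr_suml.
rewrite exchange_big [gradient _ _ _]mxE mulr_sumr; apply: eq_bigr => k _.
rewrite [covec _ _ _]mxE mulrCA -ricci_grad mulr_sumr; apply: eq_bigr => m _.
by rewrite ricciC cometricC; ring.
Qed.

Lemma d_gradE i m :
  d i (grad m 0) = phi * (m == i)%:R - \sum_l chris m i l * grad l 0.
Proof.
have /matrixP/(_ m 0) := d_grad i; rewrite mxE => ->.
rewrite mxE [X in X + _]mxE [fun_of_matrix (- _) _ _]mxE.
rewrite [fun_of_matrix (conn _ *m _) _ _]mxE [e_ _ _ _]mxE andbT.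
by congr (_ - _); apply: eq_bigr => l _; rewrite [conn _ _ _]mxE.
Qed.

Lemma scalar_curv_ricci : scalar_curv = \sum_i ricci_up i i.
Proof. by rewrite exchange_big; apply: eq_bigr => i _; rewrite /ricci_up. Qed.

(** Contract [contracted_bianchi] with [grad f] and move [grad f] inside the
divergence: [Ric(grad f)] is known by [ricci_up_grad], and the correction is
[Ric] paired with [nabla grad f = phi id]. *)
Lemma Dgrad_scalar_curv : Dgrad scalar_curv =
  - ((n%:R - 1) * divergence gphi + phi * scalar_curv) *+ 2.
Proof.
rewrite /Dgrad.
under eq_bigr => m _ do rewrite contracted_bianchi -mulr_natr mulrA.
rewrite -mulr_suml mulr_natr; congr (_ *+ 2).
have Pi i : \sum_m grad m 0 * d i (ricci_up i m) = (1 - n%:R) * d i (gphi i 0)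
   - phi * ricci_up i i + \sum_m \sum_l ricci_up i m * (chris m i l * grad l 0).
  have -> : (1 - n%:R) * d i (gphi i 0) = d i (\sum_m ricci_up i m * grad m 0).
    rewrite ricci_up_grad dM (_ : d i (1 - n%:R) = 0) ?mul0r ?add0r//.
    rewrite dD d_N d_1 -[n%:R]/(1 *+ n) -(card_ord n) -sumr_const d_sum.
    by rewrite big1 ?subr0// => _ _; exact: d_1.
  rewrite d_sum.
  under [X in _ = X - _ + _]eq_bigr => m _ do rewrite dM d_gradE mulrBr.
  rewrite !big_split /= sumrN.
  under [X in _ = _ - _ + X]eq_bigr => m _ do rewrite -mulr_sumr.
  rewrite [X in _ = _ + (X - _) - _ + _](_ : _ = phi * ricci_up i i).
    under eq_bigr => m _ do rewrite mulrC.
    ring.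
  rewrite (bigD1 i)//= eqxx mulr1 mulrC big1 ?addr0// => m /negPf ->.
  by rewrite !mulr0.
under eq_bigr => m _ do rewrite mulrBr mulrDr mulr_sumr.
rewrite big_split /= big_split /= exchange_big /=.
under eq_bigr => i _ do rewrite Pi.
rewrite !big_split /= sumrN -!mulr_sumr -scalar_curv_ricci.
have -> : \sum_m grad m 0 * (\sum_l conn_trace l * ricci_up l m) =
   (1 - n%:R) * \sum_l conn_trace l * gphi l 0.
  under eq_bigr => m _ do rewrite mulr_sumr.
  rewrite exchange_big mulr_sumr; apply: eq_bigr => l _.
  rewrite /= mulrCA -ricci_up_grad mulr_sumr; apply: eq_bigr => m _; ring.
have -> : \sum_m - (grad m 0 * (\sum_i \sum_l chris i m l * ricci_up l i)) =
  - \sum_i \sum_m \sum_l ricci_up i m * (chris m i l * grad l 0).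
  rewrite sumrN; congr (- _).
  under eq_bigr => m _ do
    (rewrite mulr_sumr; under eq_bigr => i _ do rewrite mulr_sumr).
  rewrite exchange_big /=.
  under eq_bigr => i _ do rewrite exchange_big /=.
  rewrite exchange_big; apply: eq_bigr => l _; apply: eq_bigr => i _.
  by apply: eq_bigr => m _; rewrite chrisC; ring.
by rewrite /divergence; ring.
Qed.

(** The antisymmetry of the curvature annihilates [<Rm(e_i, e_j) grad f, grad
f>], which [curv_grad] computes. *)
Lemma dphi_parallel_df i j : d i phi * d j f = d j phi * d i f.
Proof.
have : (df^T *m (curv i j *m grad)) 0 0 = 0.
  apply: double0.
  have E : df^T *m (curv i j *m grad) = df^T *m curv2 i j *m df.
    by rewrite /curv2 /gradient !mulmxA.
  have ET : (df^T *m curv2 i j *m df)^T = - (df^T *m curv2 i j *m df).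
    rewrite trmx_mul [(df^T *m _)^T]trmx_mul curv2_tr trmxK.
    by rewrite mulNmx mulmxN mulmxA.
  have /matrixP/(_ 0 0) := ET.
  by rewrite E [fun_of_matrix (_^T) _ _]mxE [fun_of_matrix (- _) _ _]mxE.
rewrite curv_grad mulmxBr -!scalemxAr -!colE !mxE => /eqP.
rewrite subr_eq0 => /eqP.
by rewrite [d j phi * _]mulrC => ->; rewrite mulrC.
Qed.

(** Here [Dgrad f] is the squared norm of [grad f]. *)
Lemma d_normgrad i : d i (Dgrad f) = (phi * d i f) *+ 2.
Proof.
have E : Dgrad f = (df^T *m grad) 0 0.
  by rewrite mxE /Dgrad; apply: eq_bigr => k _; rewrite !mxE mulrC.
have /matrixP/(_ 0 0) : dmx i (df^T *m grad) = phi *: (df^T *m e_ i) *+ 2.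
  rewrite dmxM dmx_tr d_df d_grad linearD /= trmx_mul trmxK.
  rewrite linearZ /= trmx_mul gT.
  rewrite mulmxDl mulmxBr -scalemxAl -!mulmxA -scalemxAr.
  rewrite /gradient (mulmxA g h) gh mul1mx.
  have -> : (e_ i)^T *m df = df^T *m e_ i.
    apply/matrixP => a b; rewrite !ord1.
    by rewrite mxE [RHS]mxE; apply: eq_bigr => k _; rewrite mulrC !mxE.
  by rewrite mulr2n [LHS]addrC addrA subrK.
by rewrite mxE -E => ->; rewrite -colE mulr2n !mxE mulr2n.
Qed.

(** [dphi_parallel_df] with an index raised. *)
Lemma gphi_df i k : gphi i 0 * d k f = grad i 0 * d k phi.
Proof.
rewrite ![fun_of_matrix (h *m _) i 0]mxE !mulr_suml; apply: eq_bigr => l _.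
rewrite [covec _ _ _]mxE [covec _ _ _]mxE -!mulrA dphi_parallel_df.
by rewrite [d k phi * _]mulrC.
Qed.

Lemma divergence_grad : divergence grad = n%:R * phi.
Proof.
rewrite /divergence; under eq_bigr => i _ do rewrite d_gradE eqxx mulr1.
rewrite big_split /= sumr_const card_ord -[phi *+ n]mulr_natl sumrN.
rewrite [X in _ - X](_ : _ = \sum_l conn_trace l * grad l 0) ?subrK//.
rewrite exchange_big; apply: eq_bigr => l _; rewrite mulr_suml.
by apply: eq_bigr.
Qed.

Lemma divergenceZ x X :
  divergence (x *: X) = x * divergence X + \sum_i d i x * X i 0.
Proof.
rewrite /divergence; under eq_bigr => i _ do rewrite mxE dM.
rewrite big_split /= -mulr_sumr mulrDr.
under [X in _ + _ + X]eq_bigr => i _ do rewrite mxE mulrCA.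
by rewrite -mulr_sumr; ring.
Qed.

Lemma dd_f i k : d i (d k f) = phi * g i k + \sum_m chris m i k * d m f.
Proof. by rewrite -hess subrK. Qed.

Lemma gphi_grad i : \sum_k gphi k 0 * g k i = d i phi.
Proof.
have /matrixP/(_ i 0) : g *m gphi = covec phi by rewrite mulmxA gh mul1mx.
rewrite mxE [covec _ _ _]mxE => <-.
by apply: eq_bigr => k _; rewrite metricC mulrC.
Qed.

(** The divergence of the identity [dphi (x) grad f = df (x) grad phi], paired
with [grad f]: on the left it differentiates [dphi] along [grad f], and on the
right it produces the Laplacian of [phi] times the squared norm of [grad f]. *)
Lemma Dgrad_Dgrad :
  Dgrad (Dgrad phi) =
    Dgrad f * divergence gphi - (n%:R - 2%:R) * phi * Dgrad phi.
Proof.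
have D k : Dgrad (d k phi) + n%:R * phi * d k phi =
    d k f * divergence gphi + \sum_i gphi i 0 * d i (d k f).
  have : d k phi *: grad = d k f *: gphi.
    apply/matrixP => a b; rewrite !ord1 mxE [RHS]mxE.
    by rewrite [RHS]mulrC gphi_df mulrC.
  move=> /(congr1 divergence); rewrite !divergenceZ divergence_grad => E.
  transitivity (d k phi * (n%:R * phi) + \sum_i d i (d k phi) * grad i 0).
    rewrite addrC mulrC; congr (_ + _); apply: eq_bigr => i _; exact: mulrC.
  by rewrite E; congr (_ + _); apply: eq_bigr => i _; exact: mulrC.
have E1 : Dgrad (Dgrad phi) = \sum_k Dgrad (grad k 0) * d k phi
     + \sum_k grad k 0 * Dgrad (d k phi).
  rewrite {1}/Dgrad; under eq_bigr => i _ do rewrite d_sum mulr_sumr.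
  rewrite exchange_big -big_split; apply: eq_bigr => k _ /=.
  rewrite mulr_suml mulr_sumr -big_split; apply: eq_bigr => i _ /=.
  by rewrite dM; ring.
(* The Christoffel terms of both sides, which cancel. *)
pose C := \sum_k \sum_i \sum_l chris k i l * grad l 0 * grad i 0 * d k phi.
have E2 : \sum_k Dgrad (grad k 0) * d k phi = phi * Dgrad phi - C.
  rewrite /Dgrad mulr_sumr /C -sumrB; apply: eq_bigr => k _.
  under eq_bigr => i _ do rewrite d_gradE mulrBr.
  rewrite sumrB mulrBl (bigD1 k)//= eqxx mulr1 big1 ?addr0; last first.
    by move=> i ik; rewrite eq_sym (negPf ik) !mulr0.
  congr (_ - _); first by ring.
  rewrite mulr_suml; apply: eq_bigr => i _; rewrite mulr_sumr mulr_suml.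
  by apply: eq_bigr => l _; ring.
have E3 : \sum_k grad k 0 * (\sum_i gphi i 0 * d i (d k f)) =
    phi * Dgrad phi + C.
  under eq_bigr => k _ do under eq_bigr => i _ do rewrite dd_f mulrDr mulrCA.
  under eq_bigr => k _ do rewrite big_split /= -mulr_sumr gphi_grad mulrDr.
  rewrite big_split /=; congr (_ + _).
    by rewrite /Dgrad mulr_sumr; apply: eq_bigr => k _; rewrite mulrCA.
  under eq_bigr => l _ do rewrite mulr_sumr.
  under eq_bigr => l _ do under eq_bigr => i _ do rewrite !mulr_sumr.
  rewrite /C exchange_big /= [RHS]exchange_big /=; apply: eq_bigr => i _.
  rewrite exchange_big /=; apply: eq_bigr => k _; apply: eq_bigr => l _.
  rewrite [gphi i 0 * _]mulrCA gphi_df; ring.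
have : \sum_k grad k 0 * (Dgrad (d k phi) + n%:R * phi * d k phi) =
   \sum_k grad k 0 * (d k f * divergence gphi + \sum_i gphi i 0 * d i (d k f)).
  by apply: eq_bigr => k _; rewrite D.
under eq_bigr => k _ do rewrite mulrDr [grad k 0 * (_ * d k phi)]mulrCA.
under [RHS]eq_bigr => k _ do rewrite mulrDr mulrA.
rewrite big_split [RHS]big_split /= E3 -mulr_sumr -mulr_suml -/(Dgrad f).
move=> /(congr1 (fun x => x - n%:R * phi * Dgrad phi)).
rewrite addrK => E4; rewrite E1 E2 E4; ring.
Qed.

Hypothesis dscal : forall i, d i scalar_curv = d i phi.

(** Eliminates the Laplacian of [phi] between [Dgrad_scalar_curv] and
[Dgrad_Dgrad]. *)
Theorem radial_identity :
  ((n%:R - 1) * (Dgrad (Dgrad phi) + (n%:R - 2%:R) * phi * Dgrad phi)) *+ 2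
  + Dgrad f * Dgrad phi + (Dgrad f * phi * scalar_curv) *+ 2 = 0.
Proof.
have E : Dgrad phi = Dgrad scalar_curv by apply: eq_bigr => k _; rewrite dscal.
by rewrite Dgrad_Dgrad E Dgrad_scalar_curv; ring.
Qed.

End FormalGeometry.

(** * Calculus along lines and symmetry of second derivatives *)

Section Calculus.
Context {R : realType} {V : normedModType R}.

Lemma near_eq_differentiable (F G : V -> R) (x : V) :
  (\near x, F x = G x) -> differentiable F x -> differentiable G x.
Proof.
move=> FG dF; have [dFc dFE] := (diff_locallyP _ _).1 dF.
suff GE : G \o shift x = cst (G x) + 'd F x +o_ 0 id.
  have dGE := diff_unique dFc GE.
  by apply/diff_locallyP; rewrite dGE; split.
have {}FG : \forall h \near 0, F (h + x) = G (h + x).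
  by move: FG; rewrite (near_shift 0) /=; apply: filterS => h; rewrite /= subr0.
have FGx := nbhs_singleton FG; rewrite add0r in FGx.
apply/eqaddoP => e e0; have /eqaddoP/(_ e e0) := dFE.
apply: filter_app; near=> h; have := near FG h => /(_ _) E.
by rewrite /= -!fctE /= !fctE /= -FGx -E//; near: h.
Unshelve. all: by end_near. Qed.

Lemma is_derive_lineP (F : V -> R) (x v : V) (t df : R) :
  is_derive t 1 (fun s : R => F (s *: v + x)) df <->
  is_derive (t *: v + x) v F df.
Proof.
have E : (fun h : R =>
      h^-1 *: ((F \o shift (t *: v + x)) (h *: v) - F (t *: v + x)))
  = (fun h : R => h^-1 *: (((fun s : R => F (s *: v + x)) \o shift t)
      (h *: (1 : R)) - F (t *: v + x))).
  by apply/funext => h /=; rewrite [h%:A]mulr1 scalerDl addrA.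
by split=> -[]; rewrite /derivable /derive ?E => H1 H2; split;
  rewrite /derivable /derive ?E.
Qed.

Lemma is_derive_line (F : V -> R) (x v : V) (t : R) :
  differentiable F (t *: v + x) ->
  is_derive t 1 (fun s : R => F (s *: v + x)) ('D_v F (t *: v + x)).
Proof.
by move=> dF; apply/is_derive_lineP/derivableP; exact: diff_derivable.
Qed.

Lemma is_derive_sqrt (F : V -> R) (x v : V) (df : R) :
  is_derive x v F df -> 0 < F x ->
  is_derive x v (fun y => Num.sqrt (F y)) ((2 * Num.sqrt (F x))^-1 * df).
Proof.
move=> dF F0; have x0 : 0 *: v + x = x by rewrite scale0r add0r.
rewrite -{1}x0; apply/is_derive_lineP.
apply: (@is_derive1_comp _ Num.sqrt (fun s : R => F (s *: v + x))).
  by rewrite x0; exact: is_derive1_sqrt.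
by apply/is_derive_lineP; rewrite x0.
Qed.

(** The first-order condition at an extremum, in a form that asks for the
derivative of [F] at [x] only, and in one direction only. *)
Lemma derive_gt0_not_extremum (F : V -> R) (x v : V) (l : R) (P : set V) :
  is_derive x v F l -> 0 < l -> nbhs x P ->
  (exists2 y, P y & F x < F y) /\ (exists2 y, P y & F y < F x).
Proof.
move=> [dF <-] l0 xP.
have /cvgr_gt - /(_ 0 l0) := dF; rewrite near_withinE => N.
have {}xP : \forall h \near (0 : R), P (h *: v + x).
  have : (fun h : R => h *: v + x) @ 0 --> 0 *: v + x.
    by apply: cvgD; [apply: cvgZr_tmp; exact: cvg_id | exact: cvg_cst].
  by rewrite scale0r add0r; apply.
split.
- have [h [h0 [Nh Ph]]] : exists h : R, 0 < h /\
      0 < h^-1 *: (F (h *: v + x) - F x) /\ P (h *: v + x).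
    near (0 : R)^'+ => h; exists h; split.
      by near: h; exact: nbhs_right_gt.
    split; last by near: h; apply: cvg_within; exact: xP.
    suff : h != 0 -> 0 < h^-1 *: (F (h *: v + x) - F x).
      by apply; near: h; exact: nbhs_right_neq.
    by near: h; apply: cvg_within; exact: N.
  exists (h *: v + x) => //.
  by rewrite -subr_gt0 -(pmulr_rgt0 _ (_ : 0 < h^-1)) ?invr_gt0.
- have [h [h0 [Nh Ph]]] : exists h : R, h < 0 /\
      0 < h^-1 *: (F (h *: v + x) - F x) /\ P (h *: v + x).
    near (0 : R)^'- => h; exists h; split.
      by near: h; exact: nbhs_left_lt.
    split; last by near: h; apply: cvg_within; exact: xP.
    suff : h != 0 -> 0 < h^-1 *: (F (h *: v + x) - F x).
      by apply; near: h; exact: nbhs_left_neq.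
    by near: h; apply: cvg_within; exact: N.
  exists (h *: v + x) => //.
  by rewrite -subr_lt0 -(nmulr_rgt0 _ (_ : h^-1 < 0)) ?invr_lt0.
Unshelve. all: by end_near. Qed.

(** The mean value theorem in the direction [v] reduces the second difference
to an increment of ['D_v F], to which the differentiability at [x] applies. *)
Lemma second_difference (F : V -> R) (x v w : V) :
  (\forall y \near x, differentiable F y) -> differentiable ('D_v F) x ->
  forall e, 0 < e -> \forall h \near 0^'+,
   `|F (h *: v + (h *: w + x)) - F (h *: v + x) - F (h *: w + x) + F x
      - h ^+ 2 * 'D_w ('D_v F) x| <= e * h ^+ 2.
Proof.
move=> dF dG e e0; set G := 'D_v F.
(* Two increments of length at most h (|v| + |w|) occur; the summand 1 makes C
   positive. *)
pose C := (`|v| + `|w|) + (`|v| + `|w|) + 1.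
have C0 : 0 < C by rewrite /C; have := normr_ge0 v; have := normr_ge0 w; lra.
have eC0 : 0 < e / C by rewrite divr_gt0.
have /eqaddoP/(_ _ eC0) := diff_locally dG.
move: dF => /nbhs_ballP[r /= r0 dF] /nbhs_ballP[s /= s0 Gs].
pose d := Num.min r s / C.
have rs0 : 0 < Num.min r s by rewrite lt_min r0 s0.
have d0 : 0 < d by rewrite divr_gt0.
near=> h.
have h0 : 0 < h by near: h; exact: nbhs_right_gt.
have hd : h < d by near: h; apply: nbhs_right_lt.
have small (a b : R) : `|a| <= h -> `|b| <= h ->
    `|a *: v + b *: w| <= h * (`|v| + `|w|).
  move=> ah bh; rewrite (le_trans (ler_normD _ _))// !normrZ mulrDr.
  by rewrite lerD// ler_wpM2r.
have hC : h * C < Num.min r s by rewrite -ltr_pdivlMr.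
have hCr : h * C < r by rewrite (lt_le_trans hC)// ge_min lexx.
have hCs : h * C < s by rewrite (lt_le_trans hC)// ge_min lexx orbT.
have hvw : h * (`|v| + `|w|) < h * C.
  by rewrite ltr_pM2l// /C; have := normr_ge0 v; have := normr_ge0 w; lra.
have dF' (a b : R) : `|a| <= h -> `|b| <= h ->
    differentiable F (a *: v + (b *: w + x)).
  move=> ah bh; apply: dF; rewrite -ball_normE /= distrC addrA addrK.
  by rewrite (le_lt_trans (small _ _ ah bh))// (lt_trans hvw).
have dGE (a b : R) : `|a| <= h -> `|b| <= h ->
   `|G (a *: v + (b *: w + x)) - G x - 'd G x (a *: v + b *: w)|
     <= e / C * (h * (`|v| + `|w|)).
  move=> ah bh; have := Gs (a *: v + b *: w).
  rewrite -ball_normE /= sub0r normrN => /(_ _) H.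
  have := H (le_lt_trans (small _ _ ah bh) (lt_trans hvw hCs)).
  move=> {}H.
  have -> : G (a *: v + (b *: w + x)) - G x - 'd G x (a *: v + b *: w)
    = G (a *: v + b *: w + x) - (G x + 'd G x (a *: v + b *: w)).
    by rewrite opprD !addrA.
  by apply: (le_trans H); rewrite ler_pM2l// small.
pose p (t : R) := F (t *: v + (h *: w + x)) - F (t *: v + x).
have hh : `|h| <= h by rewrite ger0_norm// ltW.
have z0 : `|0 : R| <= h by rewrite normr0 ltW.
have pd t : `|t| <= h -> is_derive t (1 : R) p
    (G (t *: v + (h *: w + x)) - G (t *: v + x)).
  move=> th; apply: is_deriveB; apply: is_derive_line; first exact: dF'.
  by have := dF' t 0 th z0; rewrite scale0r add0r.
have tb (t : R) : 0 <= t -> t <= h -> `|t| <= h by move=> *; rewrite ger0_norm.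
have [c ch pE] : exists2 c, c \in `]0, h[%R & p h - p 0 =
    (G (c *: v + (h *: w + x)) - G (c *: v + x)) * (h - 0).
  apply: (@MVT _ p (fun t => G (t *: v + (h *: w + x)) - G (t *: v + x))) => //.
    by move=> t; rewrite in_itv /= => /andP[/ltW t0 /ltW th]; apply/pd/tb.
  apply: derivable_within_continuous => t; rewrite in_itv /= => /andP[t0 th].
  by have [] := pd t (tb _ t0 th).
have chn : `|c| <= h.
  by move: ch; rewrite in_itv /= => /andP[/ltW c0 /ltW cle]; exact: tb.
have -> : F (h *: v + (h *: w + x)) - F (h *: v + x) - F (h *: w + x) + F x
    = p h - p 0.
  by rewrite /p !scale0r !add0r; ring.
have := dGE c 0 chn z0; have := dGE c h chn hh.
rewrite scale0r add0r addr0 subr0 in pE *.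
have -> : 'd G x (c *: v + h *: w) = 'd G x (c *: v) + h * 'D_w G x.
  by rewrite linearD deriveE// [X in _ + X]linearZ.
rewrite pE.
set A := G _; set B := G (_ + x); set L := 'd G x _; set D := 'D_w G x.
move=> H1 H2.
have -> : (A - B) * h - h ^+ 2 * D =
   h * ((A - G x - (L + h * D)) - (B - G x - L)) by ring.
rewrite normrM (gtr0_norm h0) (le_trans (ler_wpM2l (ltW h0) (ler_normB _ _)))//.
have := ler_wpM2l (ltW h0) (lerD H1 H2) => /le_trans; apply.
have -> : h * (e / C * (h * (`|v| + `|w|)) + e / C * (h * (`|v| + `|w|))) =
   e * h ^+ 2 * (((`|v| + `|w|) + (`|v| + `|w|)) / C) by ring.
apply: ler_piMr; first by rewrite mulr_ge0 ?exprn_ge0// ltW.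
by rewrite ler_pdivrMr// mul1r /C lerDl.
Unshelve. all: by end_near. Qed.

(** The second difference is symmetric in [v] and [w]. *)
Lemma schwarz (F : V -> R) (x v w : V) :
  (\forall y \near x, differentiable F y) ->
  differentiable ('D_v F) x -> differentiable ('D_w F) x ->
  'D_w ('D_v F) x = 'D_v ('D_w F) x.
Proof.
move=> dF dv dw; apply/eqP; rewrite -subr_eq0 -normr_eq0 eq_le normr_ge0 andbT.
apply/ler_addgt0Pr => e e0; rewrite add0r.
have e2 : 0 < e / 2 by rewrite divr_gt0.
have N1 := second_difference w dF dv e2.
have N2 := second_difference v dF dw e2.
have [h [h0 [H1 H2]]] :=
  filter_ex (filterI (nbhs_right_gt (0 : R)) (filterI N1 N2)).
rewrite (addrCA (h *: w)) in H2.
set D := _ - h ^+ 2 * _ in H1; set D' := _ - h ^+ 2 * _ in H2.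
have h20 : 0 < h ^+ 2 by rewrite exprn_gt0.
rewrite -(ler_pM2l h20) -{1}(gtr0_norm h20) -normrM.
have -> : h ^+ 2 * ('D_w ('D_v F) x - 'D_v ('D_w F) x) = D' - D.
  by rewrite /D /D'; move: ('D_w _ x) ('D_v _ x) => a b; ring.
rewrite (le_trans (ler_normB _ _))// (le_trans (lerD H2 H1))//.
by rewrite -mulrDl -splitr mulrC.
Qed.
End Calculus.

(** * Smooth functions on an open set *)

Section SmoothOn.
Context {R : realType} {n : nat} (U : set 'rV[R]_n).
Hypothesis Uo : open U.
Implicit Types (F G : 'rV[R]_n -> R) (x : 'rV[R]_n).

Lemma eq_on_near F G x : U x -> (forall y, U y -> F y = G y) ->
  \near x, F x = G x.
Proof.
by move=> Ux FG; near do apply: FG; exact: open_nbhs_nbhs.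
Unshelve. all: by end_near. Qed.

Lemma eq_on_pderiv i F G x : U x -> (forall y, U y -> F y = G y) ->
  pderiv i F x = pderiv i G x.
Proof. by move=> Ux FG; apply: near_eq_derive; exact: eq_on_near. Qed.

Lemma pderivD i F G x : differentiable F x -> differentiable G x ->
  pderiv i (fun y => F y + G y) x = pderiv i F x + pderiv i G x.
Proof. by move=> dF dG; apply: deriveD; exact: diff_derivable. Qed.

Lemma pderivN i F x : differentiable F x ->
  pderiv i (fun y => - F y) x = - pderiv i F x.
Proof. by move=> dF; apply: deriveN; exact: diff_derivable. Qed.

Lemma pderivM i F G x : differentiable F x -> differentiable G x ->
  pderiv i (fun y => F y * G y) x = pderiv i F x * G x + F x * pderiv i G x.
Proof.
move=> dF dG; rewrite /pderiv [LHS](@deriveM R); try exact: diff_derivable.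
by rewrite addrC ![_ *: _]mulrC [F x * _]mulrC.
Qed.

Lemma pderivV i F x : differentiable F x -> F x != 0 ->
  pderiv i (fun y => (F y)^-1) x = - (pderiv i F x * ((F x)^-1 * (F x)^-1)).
Proof.
move=> dF F0; rewrite /pderiv [LHS](@deriveV R)//; try exact: diff_derivable.
by rewrite scaleNr [_ *: _]mulrC expr2 invfM.
Qed.

(** Smoothness is reached through finite orders of differentiability: the
derivative of a product or of an inverse involves the function itself, so that
stability has to be proved by induction on the order. *)
Fixpoint Ck k F : Prop :=
  (forall x, U x -> differentiable F x) /\
  if k is k'.+1 then forall i, Ck k' (pderiv i F) else True.

Lemma Ck_diff k F x : Ck k F -> U x -> differentiable F x.
Proof. by case: k => [|k] /= [dF _]; exact: dF. Qed.

Lemma Ck_le k F : Ck k.+1 F -> Ck k F.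
Proof. by elim: k F => [|k IH] F [dF CF]//; split=> // i; exact: IH. Qed.

Lemma Ck_eq k F G : (forall x, U x -> F x = G x) -> Ck k F -> Ck k G.
Proof.
elim: k F G => [|k IH] F G FG [dF CF]; split => //.
- by move=> x Ux; apply: near_eq_differentiable (dF x Ux); exact: eq_on_near.
- by move=> x Ux; apply: near_eq_differentiable (dF x Ux); exact: eq_on_near.
- by move=> i; apply: IH (CF i) => x Ux; exact: eq_on_pderiv.
Qed.

Lemma CkD k F G : Ck k F -> Ck k G -> Ck k (fun x => F x + G x).
Proof.
elim: k F G => [|k IH] F G [dF CF] [dG CG]; split => //.
- by move=> x Ux; apply: differentiableD; [exact: dF | exact: dG].
- by move=> x Ux; apply: differentiableD; [exact: dF | exact: dG].
- move=> i; apply: Ck_eq (IH _ _ (CF i) (CG i)) => x Ux.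
  by rewrite pderivD; [ | exact: dF | exact: dG].
Qed.

Lemma CkN k F : Ck k F -> Ck k (fun x => - F x).
Proof.
elim: k F => [|k IH] F [dF CF]; split => //.
- by move=> x Ux; apply: differentiableN; exact: dF.
- by move=> x Ux; apply: differentiableN; exact: dF.
- move=> i; apply: Ck_eq (IH _ (CF i)) => x Ux.
  by rewrite pderivN; last exact: dF.
Qed.

Lemma Ck_cst k c : Ck k (fun=> c).
Proof.
elim: k c => [|k IH] c; split => //;
  try by move=> x _; exact: differentiable_cst.
by move=> i; apply: Ck_eq (IH 0) => x Ux; rewrite /pderiv derive_cst.
Qed.

Lemma CkM k F G : Ck k F -> Ck k G -> Ck k (fun x => F x * G x).
Proof.
elim: k F G => [|k IH] F G CF CG; split => //;
  try by move=> x Ux; apply: differentiableM;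
    [exact: Ck_diff CF Ux | exact: Ck_diff CG Ux].
move=> i; have [dF dCF] := CF; have [dG dCG] := CG.
have := CkD (IH _ _ (dCF i) (Ck_le CG)) (IH _ _ (Ck_le CF) (dCG i)).
apply: Ck_eq => x Ux; rewrite pderivM //; [exact: dF | exact: dG].
Qed.

Lemma CkV k F : (forall x, U x -> F x != 0) -> Ck k F ->
  Ck k (fun x => (F x)^-1).
Proof.
move=> F0; elim: k => [|k IH] CF; split => //;
  try by move=> x Ux; apply: differentiableV;
    [exact: Ck_diff CF Ux | exact: F0].
move=> i; have [dF dCF] := CF; have IV := IH (Ck_le CF).
apply: Ck_eq (CkN (CkM (dCF i) (CkM IV IV))) => x Ux.
by rewrite pderivV //; [exact: dF | exact: F0].
Qed.

Lemma smooth_onP F : smooth_on U F <-> forall k, Ck k F.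
Proof.
split=> [sF k | CF s].
  elim: k F sF => [|k IH] F sF; split=> //; try exact: (sF [::]).
  move=> i; apply: IH => s x Ux.
  by have := sF (rcons s i) x Ux; rewrite foldr_rcons.
have : Ck (size s) (F) by [].
elim/last_ind: s F {CF} => [|s i IH] F CF x Ux /=; first exact: Ck_diff CF Ux.
rewrite foldr_rcons; apply: IH => //.
by move: CF; rewrite size_rcons => -[_] /(_ i).
Qed.

Lemma smooth_on_diff F x : smooth_on U F -> U x -> differentiable F x.
Proof. by move=> sF; exact: (sF [::]). Qed.

Lemma smooth_on_eq F G : (forall x, U x -> F x = G x) ->
  smooth_on U F -> smooth_on U G.
Proof.
by move=> FG /smooth_onP sF; apply/smooth_onP => k; exact: Ck_eq (sF k).
Qed.

Lemma smooth_onD F G : smooth_on U F -> smooth_on U G ->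
  smooth_on U (fun x => F x + G x).
Proof.
by move=> /smooth_onP sF /smooth_onP sG; apply/smooth_onP => k; exact: CkD.
Qed.

Lemma smooth_onN F : smooth_on U F -> smooth_on U (fun x => - F x).
Proof. by move=> /smooth_onP sF; apply/smooth_onP => k; exact: CkN. Qed.

Lemma smooth_onM F G : smooth_on U F -> smooth_on U G ->
  smooth_on U (fun x => F x * G x).
Proof.
by move=> /smooth_onP sF /smooth_onP sG; apply/smooth_onP => k; exact: CkM.
Qed.

Lemma smooth_onV F : (forall x, U x -> F x != 0) -> smooth_on U F ->
  smooth_on U (fun x => (F x)^-1).
Proof. by move=> F0 /smooth_onP sF; apply/smooth_onP => k; exact: CkV. Qed.

Lemma smooth_on_cst c : smooth_on U (fun=> c).
Proof. by apply/smooth_onP => k; exact: Ck_cst. Qed.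

Lemma smooth_on_pderiv i F : smooth_on U F -> smooth_on U (pderiv i F).
Proof.
by move=> sF s x Ux; have := sF (rcons s i) x Ux; rewrite foldr_rcons.
Qed.

Lemma smooth_on_sum (I : Type) (r : seq I) (F : I -> 'rV[R]_n -> R) :
  (forall i, smooth_on U (F i)) -> smooth_on U (fun x => \sum_(i <- r) F i x).
Proof.
move=> sF; elim: r => [|i r IH].
  by apply: smooth_on_eq (smooth_on_cst 0) => x _; rewrite big_nil.
by apply: smooth_on_eq (smooth_onD (sF i) IH) => x _; rewrite big_cons.
Qed.

Lemma smooth_on_prod (I : Type) (r : seq I) (F : I -> 'rV[R]_n -> R) :
  (forall i, smooth_on U (F i)) -> smooth_on U (fun x => \prod_(i <- r) F i x).
Proof.
move=> sF; elim: r => [|i r IH].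
  by apply: smooth_on_eq (smooth_on_cst 1) => x _; rewrite big_nil.
by apply: smooth_on_eq (smooth_onM (sF i) IH) => x _; rewrite big_cons.
Qed.

Lemma smooth_on_det m (A : 'rV[R]_n -> 'M[R]_m) :
  (forall i j, smooth_on U (fun x => A x i j)) ->
  smooth_on U (fun x => \det (A x)).
Proof.
move=> sA; rewrite /determinant; apply: smooth_on_sum => s.
by apply: smooth_onM; [exact: smooth_on_cst | exact: smooth_on_prod].
Qed.

(** By Cramer's rule. *)
Lemma smooth_on_invmx m (A : 'rV[R]_n -> 'M[R]_m) :
  (forall x, U x -> A x \in unitmx) ->
  (forall i j, smooth_on U (fun x => A x i j)) ->
  forall i j, smooth_on U (fun x => invmx (A x) i j).
Proof.
move=> uA sA i j.
apply: (@smooth_on_eq (fun x =>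
  (\det (A x))^-1 * ((-1) ^+ (j + i) * \det (row' j (col' i (A x)))))).
  by move=> x Ux; rewrite /invmx uA// !mxE.
apply: smooth_onM; [apply: smooth_onV; last exact: smooth_on_det|].
  by move=> x /uA; rewrite unitmxE unitfE.
apply: smooth_onM; first exact: smooth_on_cst.
apply: smooth_on_det => k l.
apply: smooth_on_eq (sA (lift j k) (lift i l)) => x _.
by rewrite !mxE.
Qed.

Lemma pderivC i j F x : smooth_on U F -> U x ->
  pderiv i (pderiv j F) x = pderiv j (pderiv i F) x.
Proof.
move=> sF Ux; apply: schwarz;
  try by apply: smooth_on_diff Ux; exact: smooth_on_pderiv.
near=> y; apply: smooth_on_diff sF _; near: y; exact: open_nbhs_nbhs.
Unshelve. all: by end_near. Qed.

End SmoothOn.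

(** Smooth functions on [U] as a subring of all functions on the subtype [U],
where equality means equality on [U]. Extension by 0 brings them back to
functions on the whole space, which [pderiv] expects; the values outside [U] do
not affect derivatives in the open set [U]. *)
Section SmoothRing.
Context {R : realType} {n : nat} (U : set 'rV[R]_n).

Definition extend (F : U -> R) (x : 'rV[R]_n) : R :=
  if insub x is Some u then F u else 0.

Lemma extendE (F : 'rV[R]_n -> R) x : U x -> extend (F \o val) x = F x.
Proof. by move=> /mem_set Ux; rewrite /extend insubT. Qed.

(** Carries a proof that [U] is open, on which the ring structure depends. *)
Definition smooth_pred of open U : {pred U -> R} :=
  fun F => `[< smooth_on U (extend F) >].

Variable Uo : open U.

Lemma smooth_predP (F : U -> R) :
  reflect (smooth_on U (extend F)) (F \in smooth_pred Uo).
Proof. exact: asboolP. Qed.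

Lemma smooth_pred_closed : subring_closed (smooth_pred Uo).
Proof.
split.
- apply/smooth_predP.
  apply: (smooth_on_eq Uo) (smooth_on_cst Uo 1) => x /mem_set Ux.
  by rewrite /extend insubT.
- move=> F G /smooth_predP sF /smooth_predP sG; apply/smooth_predP.
  apply: (smooth_on_eq Uo) (smooth_onD Uo sF (smooth_onN Uo sG)).
  move=> x /mem_set Ux.
  by rewrite /extend insubT.
- move=> F G /smooth_predP sF /smooth_predP sG; apply/smooth_predP.
  apply: (smooth_on_eq Uo) (smooth_onM Uo sF sG) => x /mem_set Ux.
  by rewrite /extend insubT.
Qed.

Record smooth_fun := SmoothFun {
  smooth_fun_val :> U -> R;
  _ : smooth_fun_val \in smooth_pred Uo }.
HB.instance Definition _ := [isSub for smooth_fun_val].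
HB.instance Definition _ := [Choice of smooth_fun by <:].
HB.instance Definition _ :=
  GRing.SubChoice_isSubComPzRing.Build _ (smooth_pred Uo) smooth_fun
    smooth_pred_closed.

Implicit Types (F G : smooth_fun) (x : 'rV[R]_n).

Lemma smooth_extend F : smooth_on U (extend F).
Proof. exact/smooth_predP/(valP F). Qed.

Lemma smooth_fun_eq F G : (forall x, U x -> extend F x = extend G x) -> F = G.
Proof.
move=> FG; apply/val_inj/funext => u /=.
have := FG (val u) (set_mem (valP u)).
by rewrite /extend !valK.
Qed.

Lemma restrict_subproof (F : 'rV[R]_n -> R) : smooth_on U F ->
  F \o val \in smooth_pred Uo.
Proof.
move=> sF; apply/smooth_predP; apply: smooth_on_eq sF => // x Ux.
by rewrite extendE.
Qed.

Definition restrict (F : 'rV[R]_n -> R) (sF : smooth_on U F) : smooth_fun :=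
  SmoothFun (restrict_subproof sF).

Lemma restrictE (F : 'rV[R]_n -> R) (sF : smooth_on U F) x : U x ->
  extend (restrict sF) x = F x.
Proof. exact: extendE. Qed.

Definition smooth_der (i : 'I_n) F : smooth_fun :=
  restrict (smooth_on_pderiv i (smooth_extend F)).

Lemma extend0 x : extend (0 : smooth_fun) x = 0.
Proof. by rewrite /extend; case: insub. Qed.
Lemma extendD F G x : extend (F + G : smooth_fun) x = extend F x + extend G x.
Proof. by rewrite /extend; case: insub => //; rewrite addr0. Qed.
Lemma extendN F x : extend (- F : smooth_fun) x = - extend F x.
Proof. by rewrite /extend; case: insub => //; rewrite oppr0. Qed.
Lemma extendM F G x : extend (F * G : smooth_fun) x = extend F x * extend G x.
Proof. by rewrite /extend; case: insub => //; rewrite mulr0. Qed.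
Lemma extend1 x : U x -> extend (1 : smooth_fun) x = 1.
Proof. by move=> /mem_set Ux; rewrite /extend insubT. Qed.
Lemma extend_sum (I : Type) (r : seq I) (P : pred I) (F : I -> smooth_fun) x :
  extend (\sum_(i <- r | P i) F i) x = \sum_(i <- r | P i) extend (F i) x.
Proof.
by rewrite (@big_morph _ _ (fun F : smooth_fun => extend F x) 0 +%R 0 +%R)//;
  [move=> *; exact: extendD | exact: extend0].
Qed.
Lemma extendMn F m x : extend (F *+ m : smooth_fun) x = extend F x *+ m.
Proof. by elim: m => [|m IH]; rewrite ?extend0// !mulrS extendD IH. Qed.
Lemma extend_nat m x : U x -> extend (m%:R : smooth_fun) x = m%:R.
Proof. by move=> Ux; rewrite extendMn extend1. Qed.

Lemma extend_der i F x : U x ->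
  extend (smooth_der i F) x = pderiv i (extend F) x.
Proof. exact: restrictE. Qed.

Lemma smooth_derD i : {morph smooth_der i : F G / F + G}.
Proof.
move=> F G; apply: smooth_fun_eq => x Ux; rewrite extendD !extend_der//.
rewrite -pderivD; try by apply: smooth_on_diff Ux; exact: smooth_extend.
by apply: eq_on_pderiv Ux _ => // y Uy; rewrite extendD.
Qed.

Lemma smooth_derM i F G :
  smooth_der i (F * G) = smooth_der i F * G + F * smooth_der i G.
Proof.
apply: smooth_fun_eq => x Ux; rewrite extendD !extendM !extend_der//.
rewrite -pderivM; try by apply: smooth_on_diff Ux; exact: smooth_extend.
by apply: eq_on_pderiv Ux _ => // y Uy; rewrite extendM.
Qed.

Lemma smooth_derC i j F :
  smooth_der i (smooth_der j F) = smooth_der j (smooth_der i F).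
Proof.
have E k l x (Ux : U x) :
    extend (smooth_der k (smooth_der l F)) x = pderiv k (pderiv l (extend F)) x.
  apply: (etrans (extend_der k (smooth_der l F) Ux)).
  exact: (eq_on_pderiv Uo k Ux (fun y Uy => extend_der l F Uy)).
apply: smooth_fun_eq => x Ux; apply: (etrans (E i j x Ux)).
apply: (etrans (pderivC Uo i j (smooth_extend F) Ux)).
exact: (esym (E j i x Ux)).
Qed.

End SmoothRing.

(** * Solitons in one chart *)

(** The inner product of the gradients of [a] and [b]; also the derivative of
[a] along the gradient of [b]. *)
Definition grad_dot (R : realType) n (G : 'rV[R]_n -> 'M[R]_n)
    (a b : 'rV[R]_n -> R) (x : 'rV[R]_n) : R :=
  \sum_k (\sum_l invmx (G x) k l * pderiv l b x) * pderiv k a x.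

Lemma posdef_unitmx (R : realType) n (A : 'M[R]_n) :
  (forall v : 'rV[R]_n, v != 0 -> 0 < (v *m A *m v^T) 0 0) -> A \in unitmx.
Proof.
move=> pA; rewrite -row_free_unit -kermx_eq0; apply/eqP/row_matrixP => i.
rewrite row0; apply/eqP/negPn/negP => /pA.
by rewrite (sub_kermxP (row_sub i _)) mul0mx mxE ltxx.
Qed.

(** [G] is the metric and [f] the potential, both read in a chart of image [U].
The names ending in [K] denote the elements of the ring of smooth functions
that represent them. *)
Section LocalSoliton.
Context {R : realType} {n : nat} (U : set 'rV[R]_n) (Uo : open U).
Variable G : 'rV[R]_n -> 'M[R]_n.
Hypothesis G_smooth : forall a b, smooth_on U (fun x => G x a b).
Hypothesis G_sym : forall x, U x -> (G x)^T = G x.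
Hypothesis G_pos : forall x, U x ->
  forall v : 'rV[R]_n, v != 0 -> 0 < (v *m G x *m v^T) 0 0.

Let G_unit x : U x -> G x \in unitmx.
Proof. by move=> Ux; apply: posdef_unitmx => v; exact: G_pos. Qed.

Let K := smooth_fun Uo.
Let d : 'I_n -> K -> K := @smooth_der R n U Uo.
Let gK : 'M[K]_n := \matrix_(a, b) restrict Uo (G_smooth a b).
Let hK : 'M[K]_n :=
  \matrix_(a, b) restrict Uo (smooth_on_invmx Uo G_unit G_smooth a b).
Let half : K := restrict Uo (smooth_on_cst Uo 2^-1).

Let dD i : {morph d i : F F' / F + F'}. Proof. exact: smooth_derD. Qed.
Let dM i F F' : d i (F * F') = d i F * F' + F * d i F'.
Proof. exact: smooth_derM. Qed.
Let dC i j F : d i (d j F) = d j (d i F). Proof. exact: smooth_derC. Qed.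

Let gKE a b x : U x -> extend (gK a b) x = G x a b.
Proof. by move=> Ux; rewrite mxE restrictE. Qed.
Let hKE a b x : U x -> extend (hK a b) x = invmx (G x) a b.
Proof. by move=> Ux; rewrite mxE restrictE. Qed.

Let half2 : half + half = 1.
Proof.
apply: smooth_fun_eq => x Ux; rewrite extendD extend1// restrictE//; lra.
Qed.

Let gh : gK *m hK = 1%:M.
Proof.
apply/matrixP => a b; apply: smooth_fun_eq => x Ux.
rewrite [in LHS]mxE extend_sum.
have /matrixP/(_ a b) := mulmxV (G_unit Ux); rewrite mxE => E.
under eq_bigr => k _ do rewrite extendM gKE// hKE//.
by rewrite E !mxE extend_nat.
Qed.

Let hg : hK *m gK = 1%:M.
Proof.
apply/matrixP => a b; apply: smooth_fun_eq => x Ux.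
rewrite [in LHS]mxE extend_sum.
have /matrixP/(_ a b) := mulVmx (G_unit Ux); rewrite mxE => E.
under eq_bigr => k _ do rewrite extendM gKE// hKE//.
by rewrite E !mxE extend_nat.
Qed.

Let gT : gK^T = gK.
Proof.
apply/matrixP => a b; apply: smooth_fun_eq => x Ux.
by rewrite [in LHS]mxE !gKE// -{1}(G_sym Ux) mxE.
Qed.

Let dE i (F : K) (F' : 'rV[R]_n -> R) x :
  (forall y, U y -> extend F y = F' y) -> U x ->
  extend (d i F) x = pderiv i F' x.
Proof. by move=> FF' Ux; rewrite extend_der//; exact: eq_on_pderiv FF'. Qed.

Let chrisE k i j x : U x ->
  extend (chris d half gK hK k i j) x = christoffel G k i j x.
Proof.
move=> Ux; rewrite /chris /christoffel extendM restrictE//; congr (_ * _).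
rewrite extend_sum; apply: eq_bigr => l _.
rewrite extendM hKE// !extendD extendN.
congr (_ * (_ + _ - _)); apply: dE => //;
  by move=> y Uy; rewrite gKE.
Qed.

Let connE i l m x : U x ->
  extend (conn d half gK hK i l m) x = christoffel G l i m x.
Proof. by move=> Ux; rewrite mxE chrisE. Qed.

Let curvE l k i j x : U x ->
  extend (curv d half gK hK i j l k) x = riemann_coord G l k i j x.
Proof.
move=> Ux; rewrite /curv; mx_expand.
rewrite !extendD !extendN /riemann_coord sumrB.
congr (_ - _ + (_ - _)).
- by rewrite mxE; apply: dE => // y Uy; rewrite connE.
- by rewrite mxE; apply: dE => // y Uy; rewrite connE.
- rewrite mxE extend_sum; apply: eq_bigr => m _.
  by rewrite extendM (connE i l m Ux) (connE j m k Ux).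
- rewrite mxE extend_sum; apply: eq_bigr => m _.
  by rewrite extendM (connE j l m Ux) (connE i m k Ux).
Qed.

Let scalar_curvE x : U x ->
  extend (scalar_curv d half gK hK) x = scalar_coord G x.
Proof.
move=> Ux; rewrite /scalar_curv /scalar_coord /ricci_coord.
rewrite exchange_big extend_sum.
apply: eq_bigr => j _; rewrite extend_sum.
under [RHS]eq_bigr => k _ do rewrite mulr_sumr.
rewrite [RHS]exchange_big; apply: eq_bigr => i _ /=.
rewrite /curv2 mxE extend_sum; apply: eq_bigr => k _.
by rewrite extendM curvE// (cometricC gh gT) hKE// mulrC.
Qed.

Let DgradE (a b : 'rV[R]_n -> R) (aK bK : K)
    (aE : forall y, U y -> extend aK y = a y)
    (bE : forall y, U y -> extend bK y = b y) x :
  U x -> extend (Dgrad d hK bK aK) x = grad_dot G a b x.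
Proof.
move=> Ux; rewrite /Dgrad /grad_dot extend_sum; apply: eq_bigr => k _.
rewrite extendM (dE _ aE)//; congr (_ * _); rewrite mxE extend_sum.
by apply: eq_bigr => l _; rewrite [covec _ _ _ _]mxE extendM hKE// (dE _ bE).
Qed.

Lemma smooth_grad_dot a b : smooth_on U a -> smooth_on U b ->
  smooth_on U (grad_dot G a b).
Proof.
move=> sa sb.
apply: (smooth_on_eq Uo)
  (smooth_extend (Dgrad d hK (restrict Uo sb) (restrict Uo sa))).
by move=> x Ux; apply: DgradE => // y Uy; exact: restrictE.
Qed.

Lemma smooth_scalar_coord : smooth_on U (scalar_coord G).
Proof.
apply: (smooth_on_eq Uo) (smooth_extend (scalar_curv d half gK hK)).
exact: scalar_curvE.
Qed.

Variables (f : 'rV[R]_n -> R) (rho : R).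
Hypothesis f_smooth : smooth_on U f.
Hypothesis soliton : forall x, U x -> forall a b : 'I_n,
  (scalar_coord G x - rho) * G x a b = hessian_coord G f a b x.

Let phi x := scalar_coord G x - rho.

Lemma smooth_phi : smooth_on U phi.
Proof.
exact: (smooth_onD Uo smooth_scalar_coord (smooth_on_cst Uo (- rho))).
Qed.

Let fK : K := restrict Uo f_smooth.
Let phiK : K := restrict Uo smooth_phi.
Let fE x : U x -> extend fK x = f x.
Proof. by move=> Ux; rewrite restrictE. Qed.
Let phiE x : U x -> extend phiK x = phi x.
Proof. by move=> Ux; rewrite restrictE. Qed.

Let hessK i j :
  d i (d j fK) - \sum_k chris d half gK hK k i j * d k fK = phiK * gK i j.
Proof.
apply: smooth_fun_eq => x Ux; rewrite extendD extendN extendM phiE// gKE//.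
rewrite soliton// /hessian_coord extend_sum; congr (_ - _).
  by apply: dE => // y Uy; exact: dE.
by apply: eq_bigr => k _; rewrite extendM chrisE// (dE _ fE).
Qed.

Let dscalK i : d i (scalar_curv d half gK hK) = d i phiK.
Proof.
apply: smooth_fun_eq => x Ux; rewrite (dE _ scalar_curvE)// (dE _ phiE)//.
have ds := smooth_on_diff smooth_scalar_coord Ux.
rewrite /phi pderivD//.
by rewrite /pderiv derive_cst addr0.
Qed.

Lemma pderiv_normgrad i x : U x ->
  pderiv i (grad_dot G f f) x = 2 * phi x * pderiv i f x.
Proof.
move=> Ux; have := d_normgrad dD dM half2 gh hg gT hessK i.
move=> /(congr1 (fun F : K => extend F x)).
rewrite extendMn extendM phiE// (dE _ fE)// (dE _ (DgradE fE fE))// => ->.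
by rewrite -mulrA mulr_natl.
Qed.

Lemma radial_identity_coord x : U x -> let phi1 := grad_dot G phi f in
  2 * (n%:R - 1) * (grad_dot G phi1 f x + (n%:R - 2) * phi x * phi1 x)
  + grad_dot G f f x * phi1 x
  + 2 * grad_dot G f f x * phi x * scalar_coord G x = 0.
Proof.
move=> Ux phi1.
have := radial_identity dD dM dC half2 gh hg gT hessK dscalK.
move=> /(congr1 (fun F : K => extend F x)).
rewrite extend0 !(extendD, extendMn, extendM, extendN) !extend1//.
rewrite phiE// scalar_curvE//.
have P1 := DgradE phiE fE.
rewrite (DgradE P1 fE)// (DgradE fE fE)// P1// => <-.
rewrite -/phi1; move: (grad_dot _ _ _ _) => a; move: (phi1 x) => b; ring.
Qed.

Definition gradvec x : 'rV[R]_n := \row_k \sum_l invmx (G x) k l * pderiv l f x.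

Lemma grad_dot_derive a x : differentiable a x ->
  grad_dot G a f x = 'D_(gradvec x) a x.
Proof.
move=> da; rewrite deriveE// (row_sum_delta (gradvec x)) linear_sum.
by apply: eq_bigr => k _; rewrite linearZ /= mxE /pderiv deriveE.
Qed.

Let u := grad_dot G f f.
Let phi1 := grad_dot G phi f.

Let u_smooth : smooth_on U u. Proof. exact: smooth_grad_dot. Qed.
Let phi1_smooth : smooth_on U phi1.
Proof. by apply: smooth_grad_dot => //; exact: smooth_phi. Qed.

Lemma is_derive_grad a x : smooth_on U a -> U x ->
  is_derive x (gradvec x) a (grad_dot G a f x).
Proof.
move=> sa Ux; have da := smooth_on_diff sa Ux.
by rewrite grad_dot_derive//; apply: derivableP; exact: diff_derivable.
Qed.

Let gradvecM x k : U x -> (gradvec x *m G x) 0 k = pderiv k f x.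
Proof.
move=> Ux; have Gs a b : G x a b = G x b a by rewrite -{1}(G_sym Ux) mxE.
rewrite mxE; under eq_bigr => j _ do rewrite mxE mulr_suml.
rewrite exchange_big (bigD1 k)//= [X in _ + X]big1 ?addr0.
  have /matrixP/(_ k k) := mulmxV (G_unit Ux); rewrite !mxE eqxx => E.
  transitivity (pderiv k f x * \sum_j G x k j * invmx (G x) j k).
    rewrite mulr_sumr; apply: eq_bigr => j _.
    by rewrite (Gs j k); ring.
  by rewrite E mulr1.
move=> l lk; have /matrixP/(_ k l) := mulmxV (G_unit Ux).
rewrite !mxE eq_sym (negPf lk) => E.
transitivity (pderiv l f x * \sum_j G x k j * invmx (G x) j l).
  rewrite mulr_sumr; apply: eq_bigr => j _.
  by rewrite (Gs j k); ring.
by rewrite E mulr0.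
Qed.

Let uE x : U x -> u x = (gradvec x *m G x *m (gradvec x)^T) 0 0.
Proof.
move=> Ux; rewrite mxE; apply: eq_bigr => k _.
by rewrite gradvecM// !mxE mulrC.
Qed.

Lemma normgrad_ge0 x : U x -> 0 <= u x.
Proof.
move=> Ux; rewrite uE//; have [->|v0] := eqVneq (gradvec x) 0.
  by rewrite !mul0mx mxE.
by rewrite ltW// G_pos.
Qed.

Lemma normgrad_eq0 x k : U x -> u x = 0 -> pderiv k f x = 0.
Proof.
move=> Ux u0; rewrite -gradvecM//; have [->|v0] := eqVneq (gradvec x) 0.
  by rewrite mul0mx mxE.
by have := G_pos Ux v0; rewrite -uE// u0 ltxx.
Qed.

Lemma grad_dot_normgrad x : U x -> grad_dot G u f x = 2 * phi x * u x.
Proof.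
move=> Ux; rewrite {1}/grad_dot /u /grad_dot mulr_sumr; apply: eq_bigr => k _.
by rewrite -/(grad_dot G f f) pderiv_normgrad// mulrCA.
Qed.

(** Together with [grad_dot_normgrad], expresses [phi] and its derivative along
[grad f] by functions built from [f] with [grad_dot] alone, where [u] does not
vanish. *)
Lemma grad_dot_grad_dot_normgrad x : U x ->
  grad_dot G (grad_dot G u f) f x = 2 * phi1 x * u x + 4 * phi x ^+ 2 * u x.
Proof.
move=> Ux; have suf := smooth_grad_dot u_smooth f_smooth.
have [_ <-] := is_derive_grad suf Ux.
rewrite (@near_eq_derive _ _ _ _ (fun y => 2 * (phi y * u y))); last first.
  by apply: (eq_on_near Uo Ux) => y Uy; rewrite grad_dot_normgrad// mulrA.
have dphi := is_derive_grad smooth_phi Ux.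
have du := is_derive_grad u_smooth Ux.
have [_ H] := is_deriveZ 2 (is_deriveM dphi du); rewrite [LHS]H.
rewrite grad_dot_normgrad// -/phi1 /GRing.scale /=; ring.
Qed.

(** On a warped product [dr^2 + w(r)^2 k] with [w = f'(r)], this is a primitive
of [(n - 2)/2 w^(n-1) phi^2]; it comes from integrating [radial_identity_coord]
against [w^(n-3) dr]. *)
Definition flux x : R := Num.sqrt (u x) ^+ (n - 2) *
  ((n%:R - 1) * phi1 x + phi x * u x / 2 + rho * u x / n%:R).

Lemma flux_continuous x : U x -> {for x, continuous flux}.
Proof.
move=> Ux.
have C a : smooth_on U a -> {for x, continuous a}.
  by move=> sa; apply: differentiable_continuous; exact: smooth_on_diff Ux.
have Cu := C _ u_smooth; have Cp := C _ smooth_phi; have Cp1 := C _ phi1_smooth.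
have Cc (c : R) : {for x, continuous (fun=> c)} by exact: cst_continuous.
apply: continuousM.
  apply: (@continuous_comp _ _ _ _ (fun y : R => y ^+ (n - 2)));
    last exact: exprn_continuous.
  exact: (continuous_comp Cu (@sqrt_continuous _ _)).
apply: continuousD; first apply: continuousD.
- exact: continuousM.
- by apply: continuousM => //; exact: continuousM.
- by apply: continuousM => //; exact: continuousM.
Qed.

(** The derivative of [w = sqrt u] along [grad f] is [phi w]; the second
derivative of [phi] that the product rule produces is eliminated by
[radial_identity_coord]. *)
Lemma is_derive_flux x : (2 < n)%N -> U x -> 0 < u x ->
  is_derive x (gradvec x) flux
    ((n%:R - 2) / 2 * Num.sqrt (u x) ^+ n * phi x ^+ 2).
Proof.
move=> n2 Ux u0.
have du := is_derive_grad u_smooth Ux.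
have dphi := is_derive_grad smooth_phi Ux.
have dphi1 := is_derive_grad phi1_smooth Ux.
have dw := is_derive_sqrt du u0.
have dB := is_deriveD (is_deriveD (is_deriveZ (n%:R - 1) dphi1)
  (is_deriveZ 2^-1 (is_deriveM dphi du))) (is_deriveZ (rho / n%:R) du).
have dF := is_deriveM (is_deriveX (n - 2) dw) dB.
have -> : flux = (fun y => Num.sqrt (u y)) ^+ (n - 2) *
   ((n%:R - 1) *: phi1 + 2^-1 *: (phi * u) + (rho / n%:R) *: u).
  apply/funext => y; transitivity (((fun y => Num.sqrt (u y)) ^+ (n - 2)) y *
     ((n%:R - 1) * phi1 y + 2^-1 * (phi y * u y) + (rho / n%:R) * u y)) => //.
  by rewrite exprfctE /flux; congr (_ * _); ring.
apply: is_derive_eq dF _.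
rewrite !grad_dot_normgrad// exprfctE /GRing.scale /=.
have rad := radial_identity_coord Ux; rewrite /= -/phi1 -/u in rad.
have -> : ((n%:R - 1) *: phi1 + 2^-1 *: (phi * u) + (rho / n%:R) *: u) x =
  (n%:R - 1) * phi1 x + 2^-1 * (phi x * u x) + (rho / n%:R) * u x by [].
have w2 : u x = Num.sqrt (u x) ^+ 2 by rewrite sqr_sqrtr// ltW.
have w0 : Num.sqrt (u x) != 0 by rewrite gt_eqF// sqrtr_gt0.
have sE : scalar_coord G x = phi x + rho by rewrite /phi subrK.
have N0 : n%:R != 0 :> R by rewrite pnatr_eq0 -lt0n (ltn_trans _ n2).
rewrite -[in RHS](subnKC (ltnW n2)) exprD subnKC ?(ltnW n2)//.
rewrite natrB ?(ltnW n2)//.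
have -> : Num.sqrt (u x) ^+ (n - 2) =
    Num.sqrt (u x) * Num.sqrt (u x) ^+ (n - 2).-1.
  by rewrite -exprS prednK// subn_gt0.
rewrite sE in rad; move: rad N0 w0 w2; rewrite -/phi1.
move: (grad_dot G phi1 f x) (phi1 x) (phi x) (Num.sqrt (u x)) => a b p w.
move=> rad N0 w0 w2; rewrite w2 in rad *; move: rad N0 w0 {w2}.
move: (w ^+ (n - 2).-1) (n%:R : R) => W N rad N0 w0.
set lhs := LHS; set rhs := RHS; apply/eqP; rewrite -subr_eq0; apply/eqP.
rewrite -[RHS](mulr0 (w * W / 2)) -rad /lhs /rhs.
by field; rewrite N0 w0.
Qed.
End LocalSoliton.

(** * From charts to the manifold *)

Section ChainRule.
Context {R : realType} {V : normedModType R} {k : nat}.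

Lemma differentiable_row (T : V -> 'rV[R]_k) x :
  (forall c, differentiable (fun y => T y 0 c) x) -> differentiable T x.
Proof.
move=> dT.
have -> : T = \sum_(c < k) (fun y => T y 0 c *: delta_mx 0 c).
  by apply/funext => y; rewrite fct_sumE; exact: row_sum_delta.
by apply: differentiable_sum => c; exact: differentiableZl.
Qed.

Lemma derive_comp_row (F : 'rV[R]_k -> R) (T : V -> 'rV[R]_k) x v :
  (forall c, differentiable (fun y => T y 0 c) x) -> differentiable F (T x) ->
  'D_v (F \o T) x = \sum_c 'D_v (fun y => T y 0 c) x * pderiv c F (T x).
Proof.
move=> dT dF; have dTx := differentiable_row dT.
rewrite deriveE; last exact: differentiable_comp.
rewrite diff_comp//= -(deriveE _ dTx) (row_sum_delta ('D_v T x)) linear_sum.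
apply: eq_bigr => c _; rewrite linearZ /pderiv -deriveE//; congr (_ * _).
by rewrite derive_mx ?mxE//; exact: diff_derivable.
Qed.

End ChainRule.

Section Global.
Context {R : realType} {n : nat} (M : smoothManifold R n).
Variable g : riemannianMetric M.
Implicit Types (a b : M -> R) (i j : chart M) (p : M).

Let chart_img i := chart_map i @` chart_dom i.

Lemma chart_img_map i p : chart_dom i p -> chart_img i (chart_map i p).
Proof. by move=> ip; exists p. Qed.

Lemma chart_map_inv i x : chart_img i x ->
  chart_dom i (chart_inv i x) /\ chart_map i (chart_inv i x) = x.
Proof. by move=> [p ip <-]; rewrite chart_mapK. Qed.

Lemma chart_inv_cont i x : chart_img i x -> {for x, continuous (chart_inv i)}.
Proof.
move=> ix; have := @chart_inv_continuous _ _ M i.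
rewrite continuous_open_subspace; last exact: chart_image_open.
by move=> /(_ x); apply; rewrite inE.
Qed.

Lemma chart_map_cont i p : chart_dom i p -> {for p, continuous (chart_map i)}.
Proof.
move=> ip; have := @chart_map_continuous _ _ M i.
rewrite continuous_open_subspace; last exact: chart_dom_open.
by move=> /(_ p); apply; rewrite inE.
Qed.

(** The coordinates of [p] are interior to the domain of the change of charts,
which makes equalities on this domain differentiable. *)
Lemma overlap_near i j p : chart_dom i p -> chart_dom j p ->
  \forall x \near chart_map i p,
    (chart_map i @` (chart_dom i `&` chart_dom j)) x.
Proof.
move=> ip jp; have ix := chart_img_map ip.
have N1 : \forall x \near chart_map i p, chart_img i x.
  by apply: open_nbhs_nbhs; split => //; exact: chart_image_open.
have N2 : \forall x \near chart_map i p, chart_dom j (chart_inv i x).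
  apply: (chart_inv_cont ix); rewrite chart_mapK//.
  by apply: open_nbhs_nbhs; split => //; exact: chart_dom_open.
near=> x.
have ix' : chart_img i x by near: x.
have [di <-] := chart_map_inv ix'; exists (chart_inv i x) => //; split=> //.
by near: x.
Unshelve. all: by end_near. Qed.

Definition chart_at p : chart M := projT1 (cid (chart_dom_cover p)).
Lemma chart_atP p : chart_dom (chart_at p) p.
Proof. exact: (projT2 (cid (chart_dom_cover p))). Qed.

Definition manifold_grad_dot a b p : R := let i := chart_at p in
  grad_dot (g i) (a \o chart_inv i) (b \o chart_inv i) (chart_map i p).

Lemma g_unit i x : chart_img i x -> g i x \in unitmx.
Proof. by move=> ix; apply: posdef_unitmx => v v0; exact: gram_posdef. Qed.

Lemma grad_dot_mx (G : 'rV[R]_n -> 'M[R]_n) (a b : 'rV[R]_n -> R) x :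
  grad_dot G a b x =
  ((\row_k pderiv k a x) *m invmx (G x) *m (\col_k pderiv k b x)) 0 0.
Proof.
rewrite /grad_dot -mulmxA mxE; apply: eq_bigr => k _.
by rewrite !mxE mulrC; congr (_ * _); apply: eq_bigr => l _; rewrite !mxE.
Qed.

(** If [J] is the Jacobian matrix of the change of charts, differentials are
multiplied by [J] and the metric becomes [J G J^T], so that [J] cancels. *)
Lemma grad_dot_chart i j p a b : smooth_function a -> smooth_function b ->
  chart_dom i p -> chart_dom j p ->
  grad_dot (g i) (a \o chart_inv i) (b \o chart_inv i) (chart_map i p) =
  grad_dot (g j) (a \o chart_inv j) (b \o chart_inv j) (chart_map j p).
Proof.
move=> sa sb ip jp; set x := chart_map i p.
have Ox := overlap_near ip jp.
have Ux : (chart_map i @` (chart_dom i `&` chart_dom j)) x by exists p.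
pose tau y := chart_map j (chart_inv i y).
have tx : tau x = chart_map j p by rewrite /tau /x chart_mapK.
pose J : 'M[R]_n := \matrix_(k, c) pderiv k (fun y => tau y 0 c) x.
have dtau c : differentiable (fun y => tau y 0 c) x.
  exact: (@transition_smooth _ _ M i j c [::]).
have D (e : M -> R) k : smooth_function e -> pderiv k (e \o chart_inv i) x =
    \sum_c J k c * pderiv c (e \o chart_inv j) (chart_map j p).
  move=> se; transitivity (pderiv k ((e \o chart_inv j) \o tau) x).
    apply: near_eq_derive; apply: filterS Ox => y [q [iq jq] <-] /=.
    by rewrite /tau !chart_mapK.
  rewrite [LHS]derive_comp_row//; last first.
    by rewrite tx; apply: (se j [::]); exact: chart_img_map.
  by apply: eq_bigr => c _; rewrite mxE tx.
have Gij : g i x = J *m g j (chart_map j p) *m J^T.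
  apply/matrixP => k l; rewrite (gram_transition g Ux) -/tau -/(tau x) tx.
  rewrite mxE exchange_big; apply: eq_bigr => d _ /=.
  rewrite mxE mulr_suml; apply: eq_bigr => c _.
  by rewrite !mxE mulrAC.
have ui := g_unit (chart_img_map ip); have uj := g_unit (chart_img_map jp).
have uJ : J \in unitmx.
  by move: ui; rewrite Gij !unitmx_mul => /andP[/andP[]].
have uJT : J^T \in unitmx by rewrite unitmx_tr.
have Hij : J^T *m invmx (g i x) *m J = invmx (g j (chart_map j p)).
  apply: (can_inj (mulmxK uj)); rewrite mulVmx//.
  apply: (can_inj (mulmxK uJT)); rewrite mul1mx.
  transitivity (J^T *m (invmx (g i x) *m (J *m g j (chart_map j p) *m J^T))).
    by rewrite !mulmxA.
  by rewrite -Gij mulVmx// mulmx1.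
rewrite !grad_dot_mx -Hij; congr (fun_of_matrix _ _ _).
have -> : \row_k pderiv k (a \o chart_inv i) x =
   (\row_k pderiv k (a \o chart_inv j) (chart_map j p)) *m J^T.
  apply/rowP => k; rewrite !mxE D//; apply: eq_bigr => c _.
  by rewrite !mxE mulrC.
have -> : \col_k pderiv k (b \o chart_inv i) x =
   J *m (\col_k pderiv k (b \o chart_inv j) (chart_map j p)).
  by apply/colP => k; rewrite !mxE D//; apply: eq_bigr => c _; rewrite !mxE.
by rewrite !mulmxA.
Qed.

Lemma manifold_grad_dotE i p a b :
  smooth_function a -> smooth_function b -> chart_dom i p ->
  manifold_grad_dot a b p =
  grad_dot (g i) (a \o chart_inv i) (b \o chart_inv i) (chart_map i p).
Proof. by move=> sa sb ip; apply: grad_dot_chart => //; exact: chart_atP. Qed.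

Lemma manifold_grad_dot_coord i x a b :
  smooth_function a -> smooth_function b -> chart_img i x ->
  manifold_grad_dot a b (chart_inv i x) =
  grad_dot (g i) (a \o chart_inv i) (b \o chart_inv i) x.
Proof.
by move=> sa sb /chart_map_inv[ip E]; rewrite (manifold_grad_dotE sa sb ip) E.
Qed.

Lemma smooth_manifold_grad_dot a b : smooth_function a -> smooth_function b ->
  smooth_function (manifold_grad_dot a b).
Proof.
move=> sa sb i.
have oi : open (chart_img i) by exact: chart_image_open.
have := smooth_grad_dot oi (@gram_smooth _ _ _ g i) (@gram_posdef _ _ _ g i)
  (sa i) (sb i).
by apply: (smooth_on_eq oi) => x ix; rewrite /= manifold_grad_dot_coord.
Qed.

Lemma chart_continuous (A : M -> R) :
  (forall i x, chart_img i x -> {for x, continuous (A \o chart_inv i)}) ->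
  continuous A.
Proof.
move=> cA p; pose i := chart_at p.
have ip : chart_dom i p := chart_atP p.
have E : \forall q \near p, ((A \o chart_inv i) \o chart_map i) q = A q.
  have : nbhs p (chart_dom i).
    by apply: open_nbhs_nbhs; split => //; exact: chart_dom_open.
  by apply: filterS => q iq /=; rewrite chart_mapK.
apply: (cvg_trans (near_eq_cvg E)); rewrite -(nbhs_singleton E).
exact: (continuous_comp (chart_map_cont ip) (cA _ _ (chart_img_map ip))).
Qed.

Hypothesis n2 : (2 < n)%N.
Hypothesis M_compact : compact [set: M].
Variables (f : M -> R) (rho : R).
Hypothesis f_smooth : smooth_function f.
Arguments f_smooth : clear implicits.
Hypothesis solitonM : forall (i : chart M) (p : M), chart_dom i p ->
    forall a b : 'I_n,
      (scalar_curvature g i p - rho) * metric_at g i p a b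
      = hessian_at g f i p a b.

Let oi i : open (chart_img i). Proof. exact: chart_image_open. Qed.
Arguments oi : clear implicits.

Let soliton i x : chart_img i x -> forall a b : 'I_n,
  (scalar_coord (g i) x - rho) * g i x a b =
  hessian_coord (g i) (f \o chart_inv i) a b x.
Proof. by move=> [p ip <-]; exact: solitonM. Qed.

Let u := manifold_grad_dot f f.
Let v := manifold_grad_dot u f.
Let z := manifold_grad_dot v f.

Let u_smooth : smooth_function u. Proof. exact: smooth_manifold_grad_dot. Qed.
Let v_smooth : smooth_function v. Proof. exact: smooth_manifold_grad_dot. Qed.

(** [flux] as a function of [U = u] and of its first and second derivatives [V]
and [Z] along [grad f]: [phi] is [V / (2 U)] and the derivative of [phi] is [(Z
- V^2 / U) / (2 U)]. The value at [U = 0] is that of [flux], whose first factor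
vanishes there since [n > 2]. *)
Definition flux_of (U V Z : R) : R :=
  if U == 0 then 0 else Num.sqrt U ^+ (n - 2) *
    ((n%:R - 1) * ((Z - V ^+ 2 / U) / (2 * U)) + V / 4 + rho * U / n%:R).

Lemma flux_ofE (U s a : R) :
  flux_of U (2 * s * U) (2 * a * U + 4 * s ^+ 2 * U) =
  Num.sqrt U ^+ (n - 2) * ((n%:R - 1) * a + s * U / 2 + rho * U / n%:R).
Proof.
rewrite /flux_of; have [->|U0] := eqVneq U 0.
  by rewrite sqrtr0 expr0n subn_eq0 leqNgt n2 mul0r.
have N0 : n%:R != 0 :> R by rewrite pnatr_eq0 -lt0n (ltn_trans _ n2).
by congr (_ * _); field; rewrite U0 N0.
Qed.

Definition global_flux p : R := flux_of (u p) (v p) (z p).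

Let local_flux i x : R := flux (g i) (f \o chart_inv i) rho x.
Let local_normgrad i x : R :=
  grad_dot (g i) (f \o chart_inv i) (f \o chart_inv i) x.

Let u_coord i x : chart_img i x -> u (chart_inv i x) = local_normgrad i x.
Proof. by move=> ix; exact: (manifold_grad_dot_coord f_smooth f_smooth ix). Qed.

Let gs i (a b : 'I_n) := @gram_smooth _ _ _ g i a b.
Let gsym i := @gram_sym _ _ _ g i.
Let gpos i := @gram_posdef _ _ _ g i.
Arguments gs : clear implicits.
Arguments gsym : clear implicits.
Arguments gpos : clear implicits.

Let grad_dot_ext i (F F' H : 'rV[R]_n -> R) x : chart_img i x ->
  (forall y, chart_img i y -> F y = F' y) ->
  grad_dot (g i) F H x = grad_dot (g i) F' H x.
Proof.
move=> ix E; apply: eq_bigr => k _; congr (_ * _).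
exact: (eq_on_pderiv (oi i) k ix E).
Qed.

Let v_coord i x : chart_img i x ->
  v (chart_inv i x) = grad_dot (g i) (local_normgrad i) (f \o chart_inv i) x.
Proof.
move=> ix; apply: (etrans (manifold_grad_dot_coord u_smooth f_smooth ix)).
by apply: (grad_dot_ext _ ix) => y iy; exact: u_coord.
Qed.

Lemma global_flux_coord i x : chart_img i x ->
  global_flux (chart_inv i x) = local_flux i x.
Proof.
move=> ix.
have vE := etrans (v_coord ix) (grad_dot_normgrad (oi i) (gs i) (gsym i)
  (gpos i) (f_smooth i) (soliton (i := i)) ix).
have zE : z (chart_inv i x) = grad_dot (g i)
    (grad_dot (g i) (local_normgrad i) (f \o chart_inv i)) (f \o chart_inv i) x.
  apply: (etrans (manifold_grad_dot_coord v_smooth f_smooth ix)).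
  by apply: (grad_dot_ext _ ix) => y iy; exact: v_coord.
have {}zE := etrans zE (grad_dot_grad_dot_normgrad (oi i) (gs i) (gsym i)
  (gpos i) (f_smooth i) (soliton (i := i)) ix).
exact: (etrans (f_equal3 flux_of (u_coord ix) vE zE) (flux_ofE _ _ _)).
Qed.

Let flux_derive i x (ix : chart_img i x) (u0 : 0 < local_normgrad i x) :=
  is_derive_flux (oi i) (gs i) (gsym i) (gpos i) (f_smooth i)
    (soliton (i := i)) n2 ix u0.

Lemma global_flux_continuous : continuous global_flux.
Proof.
apply: chart_continuous => i x ix.
have E : \forall y \near x, local_flux i y = (global_flux \o chart_inv i) y.
  by apply: (eq_on_near (oi i) ix) => y iy /=; rewrite global_flux_coord.
have H : {for x, continuous (local_flux i)}.
  exact: (flux_continuous (oi i) (gs i) (gsym i) (gpos i) (f_smooth i) ix).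
apply: (cvg_trans (near_eq_cvg E)); rewrite -(nbhs_singleton E); exact: H.
Qed.

Let f_continuous : continuous f.
Proof.
apply: chart_continuous => i x ix; apply: differentiable_continuous.
exact: (f_smooth i [::]).
Qed.

(** Where [u > 0], the derivative of [P] along [grad f] is at least [eps u >
0]. *)
Lemma critical_flux eps p (P := fun q => global_flux q + eps * f q) :
  0 < eps -> (forall q, P q <= P p) \/ (forall q, P p <= P q) -> u p = 0.
Proof.
move=> e0 ext; pose i := chart_at p; have ip : chart_dom i p := chart_atP p.
have ix := chart_img_map ip; set x := chart_map i p in ix.
have up : u p = local_normgrad i x by rewrite -u_coord// /x chart_mapK.
rewrite up; apply/eqP/negPn/negP => u0.
have u_gt0 : 0 < local_normgrad i x.
  by rewrite lt_def u0 (normgrad_ge0 (gsym i) (gpos i) (f \o chart_inv i) ix).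
have H1 := flux_derive ix u_gt0.
have H2 := is_derive_grad (g i) (f \o chart_inv i) (f_smooth i) ix.
have H := is_deriveD H1 (is_deriveZ eps H2).
have l0 : 0 < (n%:R - 2) / 2 * Num.sqrt (local_normgrad i x) ^+ n *
    (scalar_coord (g i) x - rho) ^+ 2 + eps *: local_normgrad i x.
  apply: ltr_wpDl; last exact: mulr_gt0.
  apply: mulr_ge0; last exact: sqr_ge0.
  apply: mulr_ge0; last by rewrite exprn_ge0// sqrtr_ge0.
  by rewrite divr_ge0// subr_ge0 ler_nat ltnW.
have ni : nbhs x (chart_img i) by apply: open_nbhs_nbhs.
have [[y iy +] [y' iy' +]] := derive_gt0_not_extremum H l0 ni.
have PE w : chart_img i w -> P (chart_inv i w) =
   (flux (g i) (f \o chart_inv i) rho + eps *: (f \o chart_inv i)) w.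
  by move=> iw; rewrite /P global_flux_coord.
rewrite -!PE// /x chart_mapK// => h1 h2.
by case: ext => E; [have := E (chart_inv i y) | have := E (chart_inv i y')];
  rewrite leNgt ?h1 ?h2.
Qed.

(** Compare [P] at [p] and at its extrema, which are critical points of [f] by
[critical_flux], and let [eps] tend to 0. *)
Lemma flux_eq0 p : global_flux p = 0.
Proof.
have cP eps : continuous (fun q => global_flux q + eps * f q).
  move=> q; apply: cvgD; first exact: global_flux_continuous.
  by apply: cvgM; [exact: cvg_cst | exact: f_continuous].
have fl0 q : u q = 0 -> global_flux q = 0.
    by rewrite /global_flux /flux_of => ->; rewrite eqxx.
have M0 : [set: M] !=set0 by exists p.
have bound (B : M -> R) : continuous B ->
    (exists2 c, c \in [set: M] & forall t, t \in [set: M] -> B t <= B c) /\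
    (exists2 c, c \in [set: M] & forall t, t \in [set: M] -> B c <= B t).
  by move=> cB; split; [apply: compact_EVT_max => // |
    apply: compact_EVT_min => //]; exact: continuous_subspaceT.
have [[c1 _ fmax] [c2 _ fmin]] := bound f f_continuous.
apply/eqP; rewrite eq_le; apply/andP; split.
- apply/ler_addgt0Pr => e e0; rewrite add0r.
  (* The summand 1 only serves to make C positive. *)
  pose C := f c1 - f p + 1.
  have C0 : 0 < C by rewrite ltr_wpDl// subr_ge0 fmax ?inE.
  have [[c _ cmax] _] := bound _ (cP (e / C)).
  have eC : 0 < e / C by rewrite divr_gt0.
  have uc : u c = 0.
    by apply: (critical_flux eC); left => q; apply: cmax; rewrite inE.
  have := cmax p; rewrite inE (fl0 _ uc) add0r => /(_ I) H.
  have {}H : global_flux p <= e / C * (f c1 - f p).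
    rewrite mulrBr lerBrDr (le_trans H)// ler_pM2l// fmax ?inE//.
  apply: (le_trans H); rewrite mulrAC ler_pdivrMr// ler_pM2l// /C lerDl//.
- apply/ler_addgt0Pr => e e0; rewrite -lerBlDr sub0r.
  pose C := f p - f c2 + 1.
  have C0 : 0 < C by rewrite ltr_wpDl// subr_ge0 fmin ?inE.
  have [_ [c _ cmin]] := bound _ (cP (e / C)).
  have eC : 0 < e / C by rewrite divr_gt0.
  have uc : u c = 0.
    by apply: (critical_flux eC); right => q; apply: cmin; rewrite inE.
  have := cmin p; rewrite inE (fl0 _ uc) add0r => /(_ I) H.
  have {}H : - (e / C * (f p - f c2)) <= global_flux p.
    by rewrite mulrBr opprB lerBlDr (le_trans _ H)// ler_pM2l// fmin ?inE.
  apply: le_trans H; rewrite lerN2 mulrAC ler_pdivrMr// ler_pM2l// /C lerDl//.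
Qed.

(** As [flux] vanishes, so does its derivative along [grad f], hence [phi]
where [grad f] does not vanish. Near a point where [phi] is not 0 the gradient
of [f] would be 0, and then so would be the Hessian [phi g]. *)
Lemma scalar_curvature_soliton i p :
  chart_dom i p -> scalar_curvature g i p = rho.
Proof.
move=> ip; have ix := chart_img_map ip; rewrite /scalar_curvature.
set x := chart_map i p in ix *.
pose phi y := scalar_coord (g i) y - rho.
have uphi y : chart_img i y -> 0 < local_normgrad i y -> phi y = 0.
  move=> iy uy0.
  have [_] := flux_derive iy uy0.
  rewrite (@near_eq_derive _ _ _ _ (fun=> 0)); last first.
    apply: (eq_on_near (oi i) iy) => w iw.
    by rewrite -/(local_flux i w) -global_flux_coord// flux_eq0.
  have c0 : (n%:R - 2) / 2 * Num.sqrt (local_normgrad i y) ^+ n != 0 :> R.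
    apply: mulf_neq0; last by rewrite expf_neq0// gt_eqF// sqrtr_gt0.
    by apply: mulf_neq0; rewrite ?invr_eq0 ?subr_eq0 ?eqr_nat ?gtn_eqF.
  rewrite derive_cst => /esym/eqP.
  by rewrite mulf_eq0 (negPf c0) orFb sqrf_eq0 => /eqP.
apply/eqP; rewrite -subr_eq0 -/(phi x); apply/negPn/negP => phi0.
have cphi : {for x, continuous phi}.
  apply: differentiable_continuous.
  have := smooth_phi (oi i) (gs i) (gsym i) (gpos i) rho.
  by move=> /smooth_on_diff; apply.
have N : \forall y \near x, phi y != 0 by exact: (cvgr_neq0 (phi x) cphi phi0).
have U0 : \forall y \near x, chart_img i y /\ local_normgrad i y = 0.
  near=> y; have iy : chart_img i y by near: y; exact: open_nbhs_nbhs.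
  split=> //; apply/eqP/negPn/negP => u0.
  have /eqP : phi y = 0.
    apply: uphi => //.
    by rewrite lt_def u0 (normgrad_ge0 (gsym i) (gpos i) (f \o chart_inv i) iy).
  by apply/negP; near: y.
have df0 k : \forall y \near x, pderiv k (f \o chart_inv i) y = 0.
  apply: filterS U0 => y [iy uy0].
  exact: (normgrad_eq0 (gsym i) (gpos i) k iy uy0).
pose k : 'I_n := Ordinal (ltn_trans (isT : 0 < 2)%N n2).
have := soliton ix k k; rewrite /hessian_coord big1 ?subr0; last first.
  by move=> l _; rewrite (nbhs_singleton (df0 l)) mulr0.
rewrite {1}/pderiv (near_eq_derive _ (df0 k)) derive_cst => /eqP.
rewrite mulf_eq0 (negPf phi0) /= => /eqP gkk.
have k0 : (delta_mx 0 k : 'rV[R]_n) != 0.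
  by apply/eqP => /matrixP/(_ 0 k)/eqP; rewrite !mxE !eqxx oner_eq0.
have := gpos _ _ ix _ k0.
by rewrite -rowE trmx_delta -colE !mxE gkk ltxx.
Unshelve. all: by end_near. Qed.

End Global.

Theorem proposition1p8 (R : realType) (n : nat) (hn : (3 <= n)%N)
    (M : smoothManifold R n) (hM : compact [set: M])
    (g : riemannianMetric M) (f : M -> R)
    (hf : gradient_yamabe_soliton g f) :
  constant_scalar_curvature g.
Proof.
case: hf => sf [rho sol]; exists rho => i p ip.
exact: (scalar_curvature_soliton hn hM sf sol ip).
Qed.
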